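(* Let $W(t)$ be the workload at time $t$ of the critically loaded $S/D/1$ queue fed by a scheduled arrival process $N$ with i.i.d. perturbations $(\xi_j)_{j\in\mathbb{Z}}$ (defined in the context), started empty. Suppose that $\mathbb{E}\xi_0^-<\infty$, where $\xi_0^-=\max(-\xi_0,0)$, and that there exist constants $c>0$ and $\alpha>1$ for which $\mathbb{P}(\xi_0>x)\sim c\,x^{-\alpha}$ as $x\to\infty$. Then $$\frac{W(t)}{\log t/\log\log t}\Rightarrow \frac1\alpha$$ as $t\to\infty$, where $\Rightarrow$ denotes convergence in distribution.
   Context: $(\xi_j:j\in\mathbb{Z})$ is an i.i.d. sequence of real-valued random variables and $U$ is uniform on $[0,1]$, independent of $(\xi_j)$. Customer $j\in\mathbb{Z}$ arrives at time $j+\xi_j+U$. For $t\ge0$, $N(t)=\sum_{j\in\mathbb{Z}}I(j+\xi_j+U\in(0,t])$ is the number of arrivals in $(0,t]$. Each customer brings a unit amount of work and the server works at unit rate. With $W(0)=0$, the workload is $$W(t)=\max_{0\le s\le t}\big[(N(t)-t)-(N(s)-s)\big],\qquad t\ge0,$$ where the maximum is understood as a supremum. $g(x)\sim h(x)$ means $g(x)/h(x)\to1$. *)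

(* Defs.v *)
From mathcomp Require Import all_boot all_order all_algebra.
From mathcomp Require Import all_classical all_reals all_analysis.
Set Implicit Arguments.
Unset Strict Implicit.
Unset Printing Implicit Defensive.
Import Order.TTheory GRing.Theory Num.Theory.
Import numFieldNormedType.Exports.
Local Open Scope classical_set_scope.
Local Open Scope ring_scope.

Section Independence.
Context {d : measure_display} {T : measurableType d} {R : realType}.
Variable P : probability T R.

Definition mutually_independent (I : choiceType) (X : I -> {RV P >-> R}) : Prop :=
  forall (s : seq I) (B : I -> set R), uniq s ->
    (forall i, measurable (B i)) ->
    (P (\bigcap_(i in [set` s]) (X i @^-1` B i)) =
     \prod_(i <- s) P (X i @^-1` B i))%E.

Definition identically_distributed (I : choiceType) (X : I -> {RV P >-> R}) : Prop :=
  forall (i j : I) (B : set R), measurable B ->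
    distribution P (X i) B = distribution P (X j) B.

Definition iid (I : choiceType) (X : I -> {RV P >-> R}) : Prop :=
  mutually_independent X /\ identically_distributed X.

Definition family_sigma_algebra (I : choiceType) (X : I -> {RV P >-> R}) :
    set (set T) :=
  <<s \bigcup_(i in [set: I]) preimage_set_system [set: T] (X i) measurable >>.

Definition independent_of_family (I : choiceType) (Y : {RV P >-> R})
    (X : I -> {RV P >-> R}) : Prop :=
  forall (B : set R) (A : set T), measurable B -> family_sigma_algebra X A ->
    (P ((Y @^-1` B) `&` A) = P (Y @^-1` B) * P A)%E.

Definition uniform01 (Y : {RV P >-> R}) : Prop :=
  forall B : set R, measurable B ->
    distribution P Y B = uniform_prob (@ltr01 R) B.

(* Weak convergence to [nu] as the real parameter tends to +oo. The integral of
   the library is total, so measurability of the [X t] is part of the notion. *)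
Definition cvg_in_distribution (X : R -> T -> R)
    (nu : probability R R) : Prop :=
  (\forall t \near +oo, measurable_fun [set: T] (X t)) /\
  forall f : R -> R, continuous f -> bounded_fun f ->
    ('E_P[f \o X t] @[t --> +oo%R] --> \int[nu]_x (f x)%:E)%E.

End Independence.

Section Queue.
Context {T : Type} {R : realType}.
Variables (xi : int -> T -> R) (U : T -> R).

Definition arrival_time (j : int) (w : T) : R := j%:~R + xi j w + U w.

(* Possibly +oo at some sample points; finite almost surely when U is uniform
   on [0, 1] and the displacements are i.i.d. and independent of U, since then
   the mean number of arrivals in (0, t] is t. *)
Definition arrivals (t : R) (w : T) : \bar R :=
  \esum_(j in [set: int]) (\1_(`]0, t]%classic) (arrival_time j w))%:E.

Definition workloade (t : R) (w : T) : \bar R :=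
  ereal_sup [set ((arrivals t w - t%:E) - (arrivals s w - s%:E))%E |
              s in `[0, t]%classic].

(* For t >= 0 the value of [fine] is a junk value only on the event where
   infinitely many customers arrive in (0, t]. *)
Definition workload (t : R) (w : T) : R := fine (workloade t w).

End Queue.

(* Main.v *)
(* For 0 <= s <= t, N(t) - N(s) - (t - s) is, up to O(1), the number of customers
   late at s minus the number early at s, plus the number early at t minus the
   number late at t. The counts at t, and the early count at a given s, have
   bounded mean, so they are negligible on the scale L = log t / log log t.

   Upper bound: among the customers late at s, at most delta L are among the
   last delta L scheduled ones; the lateness of the others is a sum of
   independent indicators of mean O(L^(1 - alpha)), so that it exceeds
   (1/alpha + delta) L with probability at most
   exp(- (1 + alpha delta) log t (1 + o(1))), and a union bound over the integer
   times s <= t suffices.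

   Lower bound: cut the schedule into blocks of n = (1/alpha - delta) L customers.
   All displacements in a given block exceed n with probability P(xi > n)^n,
   which is much larger than n / t, so with high probability this happens for
   some block ending before t. At the end s of the first such block there are n
   late customers, while the early ones belong to later blocks, hence are
   independent of s. *)
Require Import Defs.
From mathcomp Require Import all_boot all_order all_algebra.
From mathcomp Require Import all_classical all_reals all_analysis.
From mathcomp Require Import measurable_realfun.
From mathcomp Require Import ring lra zify.
Import Order.TTheory GRing.Theory Num.Theory.
Import numFieldNormedType.Exports.
Local Open Scope classical_set_scope.
Local Open Scope ring_scope.

(** * Cardinals with values in the extended reals *)

(** Extended-real values, because at some sample points infinitely many customers may arrive in a
    bounded window; [arrivals] is a cardinal of this kind. *)
Definition ecard {R : realType} {I : choiceType} (Q : set I) : \bar R :=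
  \esum_(j in Q) 1%E.

Lemma ecardE {R : realType} {I : choiceType} (Q : set I) :
  ecard Q = \esum_(j in [set: I]) (\1_Q j)%:E :> \bar R.
Proof.
rewrite /ecard esum_mkcond; apply: eq_esum => j _.
by rewrite indicE; case: (j \in Q).
Qed.

Lemma ecard_ge0 {R : realType} {I : choiceType} (Q : set I) :
  (0 <= ecard Q :> \bar R)%E.
Proof. by apply: esum_ge0. Qed.

Lemma le_ecard {R : realType} {I : choiceType} (Q Q' : set I) :
  Q `<=` Q' -> (ecard Q <= ecard Q' :> \bar R)%E.
Proof.
move=> QQ'; rewrite !ecardE; apply: le_esum => j _.
rewrite lee_fin !indicE ler_nat; case: (boolP (j \in Q)) => //.
by rewrite inE => /QQ' /mem_set ->.
Qed.

Lemma ecardU {R : realType} {I : choiceType} (Q Q' : set I) :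
  [disjoint Q & Q'] -> ecard (Q `|` Q') = (ecard Q + ecard Q' :> \bar R)%E.
Proof.
move=> /disj_setPS QQ'; rewrite !ecardE -esumD; last 2 first.
- by move=> j _; rewrite lee_fin.
- by move=> j _; rewrite lee_fin.
apply: eq_esum => j _; rewrite -EFinD !indicE in_setU; congr (_%:E).
case: (boolP (j \in Q)) => jQ; case: (boolP (j \in Q')) => jQ'; rewrite /= ?addr0 ?add0r //.
by exfalso; apply: (QQ' j); move: jQ jQ'; rewrite !inE.
Qed.

Lemma ecardU_le {R : realType} {I : choiceType} (Q Q' : set I) :
  (ecard (Q `|` Q') <= ecard Q + ecard Q' :> \bar R)%E.
Proof.
rewrite -(setDUK (@subsetUl _ Q Q')) ecardU; last by apply/disj_setPS => j [? []].
by apply: leeD => //; apply: le_ecard => j [[]].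
Qed.

Lemma ecard_bij {R : realType} {I J : choiceType} (P : set I) (Q : set J) (e : I -> J) :
  set_bij P Q e -> ecard Q = ecard P :> \bar R.
Proof. exact: reindex_esum. Qed.

Lemma ecard_II {R : realType} (n : nat) : ecard `I_n = n%:R%:E :> \bar R.
Proof.
rewrite /ecard esum_fset //.
by rewrite -fsbig_ord sumEFin sumr_const card_ord.
Qed.

Lemma ecard_itv {R : realType} (a : int) (n : nat) :
  ecard [set j : int | (a <= j < a + n%:Z)%R] = n%:R%:E :> \bar R.
Proof.
rewrite -(ecard_II n); apply: (@ecard_bij _ _ _ _ _ (fun k => a + k%:Z)); split.
- by move=> k /= kn; apply/andP; lia.
- by move=> k k' _ _ /=; lia.
- move=> j /= /andP[aj jn]; exists `|j - a|%N => /=; lia.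
Qed.

Lemma ecard_series {R : realType} (Q : set nat) :
  ecard Q = (\sum_(k <oo) (\1_Q k)%:E)%E :> \bar R.
Proof. by rewrite ecardE nneseries_esum ?set_true. Qed.

Lemma ecard_finite {R : realType} {I : choiceType} (Q : set I) :
  (ecard Q < +oo :> \bar R)%E -> finite_set Q.
Proof.
rewrite ltNge => Qoo; apply: contrapT => infQ; move/negP: Qoo; apply.
rewrite leye_eq; apply/eqP/eqyP => r r0.
have [B BQ Bn] := infinite_set_fset (Num.truncn r).+1 infQ.
apply: esum_ge; eexists; first by split; [exact: finite_fset|exact: BQ].
rewrite fsbig_finite //= set_fsetK sumEFin lee_fin big_const_seq count_predT iter_addr addr0.
by apply: le_trans (ltW (truncnS_gt r)) _; rewrite ler_nat.
Qed.

Lemma ecard_seq {R : realType} {I : choiceType} (s : seq I) :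
  uniq s -> ecard [set` s] = (size s)%:R%:E :> \bar R.
Proof.
move=> us; rewrite /ecard esum_fset // -fsbig_seq // sumEFin.
by rewrite big_const_seq count_predT iter_addr addr0.
Qed.

(** A list of exactly p elements, available also for infinite Q, turns a lower bound on a count into
    a union over p-element index sets. *)
Lemma ecard_geP {R : realType} {I : choiceType} (Q : set I) (p : nat) :
  (p%:R%:E <= ecard Q :> \bar R)%E ->
  exists s : seq I, [/\ uniq s, size s = p & [set` s] `<=` Q].
Proof.
move=> pQ; suff [s [us ps sQ]] : exists s : seq I, [/\ uniq s, (p <= size s)%N & [set` s] `<=` Q].
  exists (take p s); split; [exact: take_uniq|exact: size_takel|].
  by move=> j /= /mem_take; exact: sQ.
have [finQ|infQ] := pselect (finite_set Q); last first.
  have [B BQ Bp] := infinite_set_fset p infQ.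
  by exists (finmap.enum_fset B); split => //; exact: finmap.fset_uniq.
exists (finmap.enum_fset (fset_set Q)); split; first exact: finmap.fset_uniq.
  rewrite -(ler_nat R) -lee_fin -ecard_seq; last exact: finmap.fset_uniq.
  by have -> : [set` finmap.enum_fset (fset_set Q)] = Q by exact: fset_setK.
by rewrite [X in X `<=` _](_ : _ = Q) //; exact: fset_setK.
Qed.

(** * Tail bounds for numbers of occurring events *)

Lemma ecard_indic {R : realType} {T : Type} (F : nat -> set T) (w : T) :
  ecard [set k | F k w] = (\sum_(k <oo) (\1_(F k) w)%:E)%E :> \bar R.
Proof.
rewrite ecard_series; apply: eq_eseriesr => k _.
by rewrite !indicE; congr (_%:R%:E); apply/idP/idP; rewrite !inE.
Qed.

Lemma measurable_ecard {R : realType} {d : measure_display} {T : measurableType d}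
    (F : nat -> set T) : (forall k, measurable (F k)) ->
  measurable_fun [set: T] (fun w => ecard [set k | F k w] : \bar R).
Proof.
move=> mF; rewrite (_ : (fun w => _) = (fun w => \sum_(0 <= k <oo | k \in xpredT) (\1_(F k) w)%:E)%E).
  apply: ge0_emeasurable_sum => [k x _ _|k _]; first by rewrite lee_fin.
  by apply/measurable_EFinP; exact: measurable_indic.
by apply/funext => w; exact: ecard_indic.
Qed.

Lemma integral_ecard {R : realType} {d : measure_display} {T : measurableType d}
    (P : probability T R) (F : nat -> set T) (D : set T) :
  (forall k, measurable (F k)) -> measurable D ->
  (\int[P]_(w in D) ecard [set k | F k w] = \sum_(k <oo) P (F k `&` D))%E.
Proof.
move=> mF mD; under eq_integral => w _ do rewrite ecard_indic.
rewrite integral_nneseries //.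
- by apply: eq_eseriesr => k _; rewrite integral_indic.
- by move=> k; apply/measurable_EFinP; exact: measurable_indic.
Qed.

(** Markov's inequality localised to an event D; in [first_success_bound], D is the event of a first
    success at a given index. *)
Lemma markov_ecard {R : realType} {d : measure_display} {T : measurableType d}
    (P : probability T R) (F : nat -> set T) (D : set T) (M : R) :
  (forall k, measurable (F k)) -> measurable D -> 0 < M ->
  (M%:E * P (D `&` [set w | M%:E <= ecard [set k | F k w]]) <=
   \sum_(k <oo) P (F k `&` D))%E.
Proof.
move=> mF mD M0.
have mE := measurable_ecard (R := R) F mF.
rewrite -integral_ecard //.
have absE w : `|ecard [set k | F k w] : \bar R|%E = ecard [set k | F k w].
  by rewrite gee0_abs ?ecard_ge0.
have := @le_integral_comp_abse _ _ _ P D mD (fun w => ecard [set k | F k w] : \bar R) M id.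
move=> /(_ (@measurable_id _ _ _) (fun _ h => h) (fun _ _ _ _ h => h)).
move=> /(_ (measurable_funS measurableT (@subsetT _ _) mE) M0).
under eq_integral do rewrite absE.
by under eq_set do rewrite absE.
Qed.

Lemma markov_ecardT {R : realType} {d : measure_display} {T : measurableType d}
    (P : probability T R) (F : nat -> set T) (S M : R) :
  (forall k, measurable (F k)) -> 0 < M -> (\sum_(k <oo) P (F k) <= S%:E)%E ->
  (P [set w | M%:E <= (ecard [set k | F k w] : \bar R)] <= (S / M)%:E)%E.
Proof.
move=> mF M0 FS; have := markov_ecard P F setT M mF measurableT M0.
under eq_eseriesr do rewrite setIT.
rewrite setTI => H; rewrite EFinM lee_pdivlMr // muleC; exact: le_trans H FS.
Qed.

(* With z = p / mu, z ^ p times the left-hand side is at most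
   prod_k (1 + z q_k) <= exp (z mu). *)
Lemma sum_subset_prod_le {R : realType} (K p : nat) (q : nat -> R) (mu : R) :
  (forall k, 0 <= q k) -> (0 < p)%N -> 0 < mu -> \sum_(k < K) q k <= mu ->
  \sum_(J : {set 'I_K} | #|J| == p) \prod_(k in J) q k <= (expR 1 * mu / p%:R) ^+ p.
Proof.
move=> q0 p0 mu0 qmu; have pR : 0 < p%:R :> R by rewrite ltr0n.
set z := p%:R / mu; have z0 : 0 < z by rewrite divr_gt0.
have -> : expR 1 * mu / p%:R = expR 1 / z by rewrite /z invf_div mulrA.
rewrite expr_div_n ler_pdivlMr ?exprn_gt0 // mulr_suml.
under eq_bigr => J /eqP JP do rewrite -{1}JP -prodr_const -big_split /=.
apply: (@le_trans _ _ (\prod_(k < K) (q k * z + 1))).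
  (* Expansion over all index subsets; those of size other than p contribute nonnegative terms. *)
  rewrite bigA_distr.
  rewrite [leRHS](bigID (fun J : {set 'I_K} => #|J| == p)) /=.
  rewrite -[leLHS]addr0 lerD //.
    rewrite le_eqVlt; apply/orP; left; apply/eqP; apply: eq_bigr => J _.
    by rewrite big_mkcond.
  apply: sumr_ge0 => J _; apply: prodr_ge0 => k _; case: ifP => // _.
  by rewrite mulr_ge0 // ltW.
rewrite -expRM_natl mulr1.
apply: (@le_trans _ _ (\prod_(k < K) expR (q k * z))).
  apply: ler_prod => k _; rewrite addr_ge0 ?(mulr_ge0 (q0 k) (ltW z0)) //=.
    by rewrite [q k * z + 1]addrC expR_ge1Dx.
rewrite -expR_sum ler_expR -mulr_suml -[leRHS](@divfK _ mu) ?gt_eqF//.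
by rewrite mulrC ler_pM2l.
Qed.

(** If at least p events occur, some p of them occur together: a union bound over p-subsets and
    independence give the sum estimated in [sum_subset_prod_le]. This is done for the first K
    events, and K tends to infinity by continuity from below. *)
Lemma chernoff_ecard {R : realType} {d : measure_display} {T : measurableType d}
    (P : probability T R) (F : nat -> set T) (p : nat) (mu : R) :
  (forall k, measurable (F k)) ->
  (forall s : seq nat, uniq s ->
     (P (\bigcap_(k in [set` s]) F k) = \prod_(k <- s) P (F k))%E) ->
  (0 < p)%N -> 0 < mu -> (\sum_(k <oo) P (F k) <= mu%:E)%E ->
  (P [set w | p%:R%:E <= (ecard [set k | F k w] : \bar R)] <=
   ((expR 1 * mu / p%:R) ^+ p)%:E)%E.
Proof.
move=> mF indF p0 mu0 Fmu.
pose G K k := if (k < K)%N then F k else set0.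
have mG K k : measurable (G K k) by rewrite /G; case: ifP.
pose A K := [set w | p%:R%:E <= (ecard [set k | G K k w] : \bar R)]%E.
have mA K : measurable (A K).
  rewrite -[A K]setTI; apply: (emeasurable_fun_c_infty measurableT).
  exact: measurable_ecard.
have Abound K : (P (A K) <= ((expR 1 * mu / p%:R) ^+ p)%:E)%E.
  pose B (J : {set 'I_K}) := \bigcap_(k in [set` map val (enum J)]) F k.
  have mB J : measurable (B J).
    by apply: fin_bigcap_measurable => // k _.
  have AB : A K `<=` \bigcup_(J in [set J : {set 'I_K} | #|J| == p]) B J.
    move=> w /ecard_geP[s [us sp sG]].
    have sF k : k \in s -> (k < K)%N /\ F k w.
      by move=> /sG /=; rewrite /G; case: ifP.
    exists (finset (fun k : 'I_K => val k \in s)); last first.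
      by move=> k /= /mapP[j]; rewrite mem_enum inE => /sF[_ Fj] ->.
    rewrite /= cardE -(size_map val) -sp; apply/eqP/perm_size/uniq_perm => //.
      by rewrite map_inj_uniq ?enum_uniq //; exact: val_inj.
    move=> k; apply/mapP/idP => [[j]|ks]; first by rewrite mem_enum inE => js ->.
    by exists (Ordinal (sF _ ks).1); rewrite ?mem_enum ?inE.
  apply: (le_trans (content_sub_fsum P finite_finset (fun J _ => mB J) (mA K) AB)).
  rewrite -(bigfs _ (r := index_enum {set 'I_K})); last 2 first.
  - exact: index_enum_uniq.
  - by move=> J _; rewrite mem_index_enum.
  pose q k := fine (P (F k)).
  have qE k : P (F k) = (q k)%:E by rewrite /q fineK // fin_num_measure.
  rewrite (eq_bigr (fun J : {set 'I_K} => (\prod_(k in J) q k)%:E)); last first.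
    move=> J _; transitivity (\prod_(k <- map val (enum J)) P (F k))%E.
      by apply: indF; rewrite map_inj_uniq ?enum_uniq //; exact: val_inj.
    by rewrite big_map big_enum /= -prodEFin; apply: eq_bigr => k _.
  rewrite sumEFin lee_fin; apply: sum_subset_prod_le => //.
    by move=> k; rewrite /q fine_ge0.
  rewrite -lee_fin -sumEFin; apply: le_trans Fmu.
  under eq_bigr do rewrite -qE.
  rewrite -(big_mkord xpredT (fun k => P (F k))).
  by apply: nneseries_lim_ge => k _ _; exact: measure_ge0.
have Aup : {homo A : n m / (n <= m)%N >-> (n <= m)%O}.
  move=> n m nm; apply/subsetPset => w; rewrite /A /=.
  move=> /le_trans; apply; apply: le_ecard => k /=; rewrite /G.
  by case: ifP => // kn; rewrite (leq_trans kn nm).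
have AE : [set w | p%:R%:E <= (ecard [set k | F k w] : \bar R)]%E = \bigcup_K A K.
  apply/seteqP; split => w /=.
    move=> /ecard_geP[s [us sp sF]].
    exists (\max_(k <- s) k.+1)%N => //=; rewrite /A /=.
    rewrite -sp -ecard_seq //; apply: le_ecard => k ks; rewrite /= /G ifT; first exact: sF.
    exact: (@leq_bigmax_seq _ s xpredT (fun k => k.+1)).
  move=> [K _]; rewrite /A /= => /le_trans; apply; apply: le_ecard => k /=.
  by rewrite /G; case: ifP.
rewrite AE.
have mUA : measurable (\bigcup_K A K) by exact: bigcup_measurable.
have cvgA : (P \o A) x @[x --> \oo] --> P (\bigcup_K A K).
  exact: nondecreasing_cvg_mu mA mUA Aup.
rewrite -(cvg_lim _ cvgA) //; apply: lime_le.
  by apply/cvg_ex; eexists; exact: cvgA.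
by near=> K; exact: Abound.
Unshelve. all: by end_near.
Qed.

(** * Independent trials up to the first success *)

Lemma bigcap_cons {I : choiceType} {T : Type} (a : I) (s : seq I) (E : I -> set T) :
  \bigcap_(i in [set` a :: s]) E i = E a `&` \bigcap_(i in [set` s]) E i.
Proof. by rewrite !bigcap_seq big_cons. Qed.

(** Induction on the list of complemented events: P(X minus E a) = P(X) - P(X and E a), where the
    last term has [a] in the other list. The bound n allows for an event F whose independence from E
    i is known only for i < n. *)
Lemma prob_bigcap_setC {R : realType} {d : measure_display} {T : measurableType d}
    (P : probability T R) (E : nat -> set T) (F : set T) (q : nat -> R) (pF : R) (n : nat) :
  (forall i, measurable (E i)) -> measurable F ->
  (forall s, uniq s -> all (fun i => i < n)%N s ->
     P (F `&` \bigcap_(i in [set` s]) E i) = (pF * \prod_(i <- s) q i)%:E) ->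
  forall s' s, uniq (s ++ s') -> all (fun i => i < n)%N (s ++ s') ->
  P (F `&` \bigcap_(i in [set` s]) E i `&` \bigcap_(i in [set` s']) ~` E i) =
  (pF * (\prod_(i <- s) q i) * \prod_(i <- s') (1 - q i))%:E.
Proof.
move=> mE mF indE; elim => [|a s' IH] s us sn.
  rewrite cats0 in us sn.
  by rewrite [X in _ `&` X]bigcap_seq !big_nil setIT mulr1; exact: indE.
have mcap (t : seq nat) (C : nat -> set T) : (forall i, measurable (C i)) ->
    measurable (\bigcap_(i in [set` t]) C i).
  by move=> mC; apply: fin_bigcap_measurable.
have mCE i : measurable (~` E i) by exact: measurableC.
have usa : uniq ((a :: s) ++ s') by rewrite -(perm_uniq (permEl (perm_catCA s [:: a] s'))).
have sna : all (fun i => i < n)%N ((a :: s) ++ s').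
  by rewrite -(perm_all _ (permEl (perm_catCA s [:: a] s'))).
have /(IH s) Hs : uniq (s ++ s') by move: usa => /= /andP[].
have {}Hs := Hs (_ : all (fun i => i < n)%N (s ++ s')).
have {}Hs := Hs (proj2 (andP sna)).
have := IH (a :: s) usa sna; rewrite bigcap_cons big_cons => Ha.
set X := F `&` _ `&` _ in Hs.
have mX : measurable X by do 2?apply: measurableI => //; exact: mcap.
have : P X = (P (X `\` E a) + P (X `&` E a))%E by exact: measureDI.
rewrite Hs.
have -> : X `&` E a = F `&` (E a `&` \bigcap_(i in [set` s]) E i) `&`
    \bigcap_(i in [set` s']) ~` E i.
  by rewrite /X setIAC -(setIA F) (setIC _ (E a)).
rewrite Ha bigcap_cons.
have -> : F `&` \bigcap_(i in [set` s]) E i `&` (~` E a `&` \bigcap_(i in [set` s']) ~` E i) = X `\` E a.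
  by rewrite setDE /X [~` E a `&` _]setIC setIA.
have mXa : measurable (X `\` E a) by exact: measurableD.
rewrite -(fineK (fin_num_measure P _ mXa)) -EFinD => -[] /eqP H; congr (_%:E).
by rewrite big_cons; apply/eqP; move: H; rewrite -subr_eq => /eqP <-; apply/eqP; ring.
Qed.

(* Split according to the first i with E i: this event is independent of every
   G i k, so Markov's inequality bounds its intersection with the event that
   at least M of the G i k occur by its probability times S / M. *)
Lemma first_success_bound {R : realType} {d : measure_display} {T : measurableType d}
    (P : probability T R) (E : nat -> set T) (G : nat -> nat -> set T) (q S M : R) (n : nat) :
  (forall i, measurable (E i)) -> (forall i k, measurable (G i k)) ->
  (forall s, uniq s -> P (\bigcap_(i in [set` s]) E i) = (q ^+ size s)%:E) ->
  (forall i k s, uniq s -> all (fun j => j < i.+1)%N s ->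
     P (G i k `&` \bigcap_(j in [set` s]) E j) = (P (G i k) * (q ^+ size s)%:E)%E) ->
  (forall i, \sum_(k <oo) P (G i k) <= S%:E)%E -> 0 <= q -> q <= 1 -> 0 < M -> 0 <= S ->
  (P (\bigcap_(i in `I_n) (~` E i `|` [set w | M%:E <= (ecard [set k | G i k w] : \bar R)])) <=
   ((1 - q) ^+ n + S / M)%:E)%E.
Proof.
move=> mE mG indE indGE GS q0 q1 M0 S0.
(* First success at i, written with lists to match [prob_bigcap_setC]. *)
pose D i := \bigcap_(j in [set` [:: i]]) E j `&` \bigcap_(j in [set` iota 0 i]) ~` E j.
pose L i := [set w | M%:E <= (ecard [set k | G i k w] : \bar R)]%E.
have mL i : measurable (L i).
  rewrite -[L i]setTI; apply: (emeasurable_fun_c_infty measurableT).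
  exact: measurable_ecard.
have mD i : measurable (D i).
  by apply: measurableI; apply: fin_bigcap_measurable => // j _; exact: measurableC.
have nil_iota i : uniq ([:: i] ++ iota 0 i) /\ all (fun j => j < i.+1)%N ([:: i] ++ iota 0 i).
  split; first by rewrite /= iota_uniq mem_iota add0n ltnn andbF.
  by rewrite /= ltnSn /=; apply/allP => j; rewrite mem_iota add0n => /andP[_ /ltnW].
have prodq (s : seq nat) x : \prod_(i <- s) x = x ^+ size s :> R.
  by rewrite big_const_seq count_predT iter_mulr mulr1.
have PD i : P (D i) = (q * (1 - q) ^+ i)%:E.
  have [u a] := nil_iota i.
  have := @prob_bigcap_setC _ _ _ P E setT (fun=> q) 1 i.+1 mE measurableT _ _ _ u a.
  rewrite setTI !prodq /= size_iota expr1 mul1r; apply => s us _.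
  by rewrite setTI prodq mul1r; exact: indE.
have PGD i k : P (G i k `&` D i) = (P (G i k) * P (D i))%E.
  have [u a] := nil_iota i.
  have fG : P (G i k) \is a fin_num by rewrite fin_num_measure.
  have := @prob_bigcap_setC _ _ _ P E (G i k) (fun=> q) (fine (P (G i k)))
    i.+1 mE (mG i k) _ _ _ u a.
  rewrite !prodq /= size_iota expr1 -setIA => ->; last first.
    by move=> s us sa; rewrite prodq indGE // EFinM fineK.
  by rewrite -mulrA EFinM fineK // PD.
have PDL i : (P (D i `&` L i) <= (q * (1 - q) ^+ i * (S / M))%:E)%E.
  have := markov_ecard P (G i) (D i) M (mG i) (mD i) M0.
  rewrite (eq_eseriesr (g := fun k => (fine (P (D i)))%:E * P (G i k))%E); last first.
    by move=> k _; rewrite PGD fineK ?fin_num_measure // muleC.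
  rewrite nneseriesZl; last by move=> k _; exact: measure_ge0.
  rewrite PD /= => H.
  rewrite mulrA EFinM lee_pdivlMr // muleC; apply: le_trans H _.
  by rewrite [X in (_ <= X)%E]EFinM; apply: lee_wpmul2l;
    rewrite ?GS // lee_fin mulr_ge0 ?exprn_ge0 ?subr_ge0.
have sumq : \sum_(i < n) q * (1 - q) ^+ i = 1 - (1 - q) ^+ n.
  elim: (n) => [|m IH]; first by rewrite big_ord0 expr0 subrr.
  by rewrite big_ord_recr /= IH exprS; ring.
(* Either none of the first n events occurs, or the first that does, say E i, comes with L i. *)
have sub : \bigcap_(i in `I_n) (~` E i `|` L i) `<=`
    \bigcap_(i in [set` iota 0 n]) ~` E i `|` \big[setU/set0]_(i < n) (D i `&` L i).
  move=> w wEL; have [Ew|] := pselect (exists i, `[< (i < n)%N /\ E i w >]); last first.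
    move=> nE; left => i /=; rewrite mem_iota => /andP[_ i_n] Ei.
    by apply: nE; exists i; apply/asboolP.
  right; have [i /asboolP[i_n Ei] imin] := ex_minnP Ew.
  rewrite -(bigcup_mkord n (fun i => D i `&` L i)); exists i => //; split.
    split; first by move=> j /=; rewrite inE => /eqP ->.
    move=> j /=; rewrite mem_iota => /andP[_ ji] Ej.
    have : (i <= j)%N by apply: imin; apply/asboolP; split => //; exact: ltn_trans ji i_n.
    by rewrite leqNgt; move/negP; apply.
  by case: (wEL i i_n).
have mN : measurable (\bigcap_(i in [set` iota 0 n]) ~` E i).
  by apply: fin_bigcap_measurable => // i _; exact: measurableC.
have mDL : measurable (\big[setU/set0]_(i < n) (D i `&` L i)).
  by apply: bigsetU_measurable => i _; exact: measurableI.
apply: (@le_trans _ _ (P (\bigcap_(i in [set` iota 0 n]) ~` E i `|`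
  \big[setU/set0]_(i < n) (D i `&` L i)))).
  apply: le_measure; rewrite ?inE //; last exact: measurableU.
  apply: bigcap_measurableType => i _; apply: measurableU; [exact: measurableC|exact: mL].
apply: le_trans (measureU2 _ mN mDL) _; rewrite EFinD leeD //.
  have := @prob_bigcap_setC _ _ _ P E setT (fun=> q) 1 n mE measurableT _ (iota 0 n) [::].
  rewrite big_nil !mul1r [X in setT `&` X]bigcap_seq big_nil !setTI prodq size_iota => H.
  rewrite le_eqVlt; apply/orP; left; apply/eqP; apply: H => //.
  - by move=> s us _; rewrite setTI prodq mul1r; exact: indE.
  - exact: iota_uniq.
  - by apply/allP => j; rewrite mem_iota add0n => /andP[].
apply: (@le_trans _ _ (\sum_(i < n) (q * (1 - q) ^+ i * (S / M))%:E)%E).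
  apply: (@le_trans _ _ (\sum_(i < n) P (D i `&` L i))%E).
    by apply: (@Boole_inequality _ _ _ P (fun i => D i `&` L i)) => i _; exact: measurableI.
  by apply: lee_sum.
rewrite sumEFin lee_fin -mulr_suml sumq ler_piMl ?divr_ge0 ?(ltW M0) //.
by rewrite gerBl exprn_ge0 // subr_ge0.
Qed.

(** * Late and early customers *)

(* Since 0 <= U <= 1, a customer j < m - r0 arriving after a time s >= m has a
   displacement larger than m - 1 - j, hence lies in [late m r0 r] for
   r = m - 1 - j - r0; the r0 last customers scheduled before m are left out.
   Symmetrically, a customer a + k arriving before time a lies in [early a k]. *)
Definition late {R : realType} {T : Type} (xi : int -> T -> R) (m r0 r : nat) : set T :=
  xi (m%:Z - (r0 + r).+1%:Z) @^-1` `](r0 + r)%:R, +oo[.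

Definition early {R : realType} {T : Type} (xi : int -> T -> R) (a k : nat) : set T :=
  xi (a%:Z + k%:Z) @^-1` `]-oo, - k%:R].

(** Links the two uses of these events: the probability bounds count over nat, the window
    decompositions over the customers j themselves. The same goes for [ecard_early]. *)
Lemma ecard_late {R : realType} {T : Type} (xi : int -> T -> R) (m r0 : nat) (w : T) :
  ecard [set r | late xi m r0 r w] =
  ecard [set j : int | (j < m%:Z - r0%:Z) /\ (m%:Z - 1 - j)%:~R < xi j w] :> \bar R.
Proof.
symmetry; apply: (@ecard_bij _ _ _ _ _ (fun r => m%:Z - (r0 + r).+1%:Z)); split.
- move=> r; rewrite /late /= in_itv andbT => rl; split; first lia.
  by rewrite (_ : m%:Z - 1 - _ = (r0 + r)%:Z) ?pmulrn //; lia.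
- by move=> r r' _ _ /=; lia.
- move=> j /= [jm jx]; set k := absz (m%:Z - r0%:Z - 1 - j)%R.
  have kj : m%:Z - (r0 + k).+1%:Z = j by lia.
  exists k => //; rewrite /late /= in_itv andbT kj.
  by rewrite (_ : (r0 + _)%N%:R = (m%:Z - 1 - j)%:~R :> R) // pmulrn; congr (_%:~R); lia.
Qed.

Lemma ecard_early {R : realType} {T : Type} (xi : int -> T -> R) (a : nat) (w : T) :
  ecard [set k | early xi a k w] =
  ecard [set j : int | (a%:Z <= j) /\ xi j w <= (a%:Z - j)%:~R] :> \bar R.
Proof.
symmetry; apply: (@ecard_bij _ _ _ _ _ (fun k => a%:Z + k%:Z)); split.
- move=> k; rewrite /early /= in_itv /= => ke; split; first lia.
  by rewrite (_ : a%:Z - _ = - k%:Z) ?mulrNz ?pmulrn //; lia.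
- by move=> k k' _ _ /=; lia.
- move=> j /= [aj jx]; exists (absz (j - a%:Z)%R); last by lia.
  rewrite /early /= in_itv /=.
  rewrite (_ : a%:Z + _ = j); last by lia.
  by rewrite (_ : - _%:R = (a%:Z - j)%:~R :> R) // pmulrn -mulrNz; congr (_%:~R); lia.
Qed.

(** * Arrivals in a time window and bounds on the workload *)

Lemma arrivals_ecard {R : realType} {T : Type} (xi : int -> T -> R) (U : T -> R) (t : R) (w : T) :
  arrivals xi U t w = ecard [set j | 0 < arrival_time xi U j w <= t].
Proof.
rewrite ecardE; apply: eq_esum => j _; rewrite !indicE; congr (_%:R%:E).
Qed.

Lemma arrivals_ge0 {R : realType} {T : Type} (xi : int -> T -> R) (U : T -> R) (t : R) (w : T) :
  (0 <= arrivals xi U t w)%E.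
Proof. by rewrite arrivals_ecard ecard_ge0. Qed.

Lemma arrivals_split {R : realType} {T : Type} (xi : int -> T -> R) (U : T -> R) (s t : R) (w : T) :
  0 <= s -> s <= t -> arrivals xi U t w =
  (arrivals xi U s w + ecard [set j | (s < arrival_time xi U j w <= t)%R])%E.
Proof.
move=> s0 st; rewrite !arrivals_ecard -ecardU; last first.
  by apply/disj_setPS => j /= [/andP[_ js] /andP[sj _]]; move: js; rewrite leNgt sj.
congr ecard; apply/seteqP; split => j /=.
  by move=> /andP[j0 jt]; rewrite j0 jt /= andbT; case: (leP (arrival_time xi U j w) s); [left|right].
move=> [/andP[j0 js]|/andP[sj jt]]; first by rewrite j0 (le_trans js st).
by rewrite jt (le_lt_trans s0 sj).
Qed.

(** Finiteness of N(t), and hence of N(s), excludes a difference of two infinities. *)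
Lemma increment_ecard {R : realType} {T : Type} (xi : int -> T -> R) (U : T -> R) (s t : R) (w : T) :
  0 <= s -> s <= t -> (arrivals xi U t w < +oo)%E ->
  ((arrivals xi U t w - t%:E) - (arrivals xi U s w - s%:E) =
   ecard [set j | (s < arrival_time xi U j w <= t)%R] - (t - s)%:E)%E.
Proof.
move=> s0 st; have Nt := arrivals_split xi U s t w s0 st; rewrite Nt.
have := arrivals_ge0 xi U s w; have := @ecard_ge0 R _ [set j | s < arrival_time xi U j w <= t].
case: (arrivals xi U s w) => [x| |]; case: (ecard _) => [y| |] //= _ _ _.
by congr (_%:E); lra.
Qed.

(** With m and n the integer parts of s and t, a customer arriving in (s, t] is scheduled at n + 1
    or later and is early, or before m - r0 and is late, or is one of the n - m + 1 + r0 customers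
    in between. Replacing n - m by t - s costs at most 1 more, whence r0 + 2. *)
Lemma window_le {R : realType} {T : Type} (xi : int -> T -> R) (U : T -> R) (s t : R) (r0 : nat) (w : T) :
  0 <= U w <= 1 -> 0 <= s -> s <= t ->
  (ecard [set j | (s < arrival_time xi U j w <= t)%R] - (t - s)%:E <=
   ecard [set k | early xi (Num.truncn t).+1 k w] +
   ecard [set r | late xi (Num.truncn s) r0 r w] + (r0%:R + 2)%:E :> \bar R)%E.
Proof.
move=> /andP[U0 U1] s0 st; have t0 := le_trans s0 st.
have /andP[ns1 ns2] := truncn_itv s0; have /andP[nt1 nt2] := truncn_itv t0.
set m := Num.truncn s in ns1 ns2 *; set n := Num.truncn t in nt1 nt2 *.
have mn : (m <= n)%N by rewrite -ltnS -(ltr_nat R); apply: le_lt_trans nt2; exact: le_trans st.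
have H : (ecard [set j | (s < arrival_time xi U j w <= t)%R] <=
   ecard [set k | early xi n.+1 k w] + ecard [set r | late xi m r0 r w] +
   (n - m + 1 + r0)%:R%:E :> \bar R)%E.
  rewrite ecard_early ecard_late -(ecard_itv (m%:Z - r0%:Z)).
  apply: (@le_trans _ _ (ecard ([set j : int | (n.+1%:Z <= j) /\ xi j w <= (n.+1%:Z - j)%:~R] `|`
     [set j : int | (j < m%:Z - r0%:Z) /\ (m%:Z - 1 - j)%:~R < xi j w] `|`
     [set j : int | m%:Z - r0%:Z <= j < m%:Z - r0%:Z + (n - m + 1 + r0)%:Z]))).
    apply: le_ecard => j /=; rewrite /arrival_time => /andP[sj jt].
    case: (lerP (n.+1%:Z) j) => nj.
      left; left; split => //; rewrite intrB -pmulrn.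
      by move: nt2 jt U0; set X := xi j w; set Y := j%:~R; set Z := n.+1%:R; lra.
    case: (ltrP j (m%:Z - r0%:Z)) => jm.
      left; right; split => //; rewrite !intrB -pmulrn.
      by move: ns1 sj U1; set X := xi j w; set Y := j%:~R; set Z := m%:R; lra.
    by right; apply/andP; split => //; lia.
  apply: le_trans (ecardU_le _ _) _; rewrite leeD2r //; exact: ecardU_le.
have := @ecard_ge0 R _ [set k | early xi n.+1 k w].
have := @ecard_ge0 R _ [set r | late xi m r0 r w].
have := @ecard_ge0 R _ [set j | s < arrival_time xi U j w <= t].
move: H; case: (ecard [set j | _]) => [x| |]; case: (ecard [set k | _]) => [y| |];
  case: (ecard [set r | _]) => [z| |] //=; rewrite ?leey // !lee_fin.
rewrite !natrD natrB // => H _ _ _.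
by move: H nt1 nt2 ns1 ns2; rewrite -!natr1; lra.
Qed.

(** Let m be the integer part of t. Among the m - a + n customers from a - n to m - 1, those before
    a arrive after a, their displacement exceeding n. So any customer missing from the window (a, t]
    is early at a, late at t, or one of the last r0. *)
Lemma window_ge {R : realType} {T : Type} (xi : int -> T -> R) (U : T -> R) (t : R) (a n r0 : nat) (w : T) :
  0 <= U w <= 1 -> a%:R <= t ->
  (forall j : int, a%:Z - n%:Z <= j < a%:Z -> n%:R < xi j w) ->
  (n%:R%:E + (t - a%:R)%:E <= ecard [set j | (a%:R < arrival_time xi U j w <= t)%R] +
   ecard [set k | early xi a k w] +
   ecard [set r | late xi (Num.truncn t) r0 r w] + (r0%:R + 1)%:E :> \bar R)%E.
Proof.
move=> /andP[U0 U1] at_ big; have t0 : 0 <= t by apply: le_trans at_.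
have /andP[nt1 nt2] := truncn_itv t0.
set m := Num.truncn t in nt1 nt2 *.
have am : (a <= m)%N by rewrite -ltnS -(ltr_nat R); exact: le_lt_trans nt2.
have H : ((m - a + n)%:R%:E <= ecard [set j | (a%:R < arrival_time xi U j w <= t)%R] +
   ecard [set k | early xi a k w] +
   ecard [set r | late xi m r0 r w] + r0%:R%:E :> \bar R)%E.
  rewrite ecard_early ecard_late -(ecard_itv (m%:Z - r0%:Z) r0) -(ecard_itv (a%:Z - n%:Z) (m - a + n)).
  apply: (@le_trans _ _ (ecard ([set j | (a%:R < arrival_time xi U j w <= t)%R] `|`
     [set j : int | (a%:Z <= j) /\ xi j w <= (a%:Z - j)%:~R] `|`
     [set j : int | (j < m%:Z - r0%:Z) /\ (m%:Z - 1 - j)%:~R < xi j w] `|`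
     [set j : int | m%:Z - r0%:Z <= j < m%:Z - r0%:Z + r0%:Z]))).
    apply: le_ecard => j /= /andP[j1 j2].
    have [jr|jr] := lerP (m%:Z - r0%:Z) j; first by right; apply/andP; split => //; lia.
    have [jt|jt] := lerP (arrival_time xi U j w) t; last first.
      left; right; split => //; move: jt; rewrite /arrival_time !intrB -pmulrn.
      by move: nt1 U1; set X := xi j w; set Y := j%:~R; set Z := m%:R; lra.
    left; left; have [ja|ja] := lerP (arrival_time xi U j w) a%:R; last by left.
    right; move: ja; rewrite /arrival_time => ja.
    have [aj|aj] := lerP a%:Z j.
      split=> //; rewrite intrB -pmulrn.
      by move: ja U0; set X := xi j w; set Y := j%:~R; set Z := a%:R; lra.
    have := big j; rewrite j1 aj => /(_ isT) nx.
    have : (a%:Z - n%:Z)%:~R <= j%:~R :> R by rewrite ler_int.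
    rewrite intrB -!pmulrn => jR; exfalso.
    by move: ja U0 nx jR; set X := xi j w; set Y := j%:~R; set Z := a%:R; lra.
  apply: le_trans (ecardU_le _ _) _; rewrite leeD2r //.
  apply: le_trans (ecardU_le _ _) _; rewrite leeD2r //; exact: ecardU_le.
have := @ecard_ge0 R _ [set k | early xi a k w].
have := @ecard_ge0 R _ [set r | late xi m r0 r w].
have := @ecard_ge0 R _ [set j | a%:R < arrival_time xi U j w <= t].
move: H; case: (ecard [set j | _]) => [x| |]; case: (ecard [set k | _]) => [y| |];
  case: (ecard [set r | _]) => [z| |] //=; rewrite ?leey // !lee_fin.
rewrite !natrD natrB // => H _ _ _.
by move: H nt1 nt2; rewrite -!natr1; lra.
Qed.

(** Late customers are counted only at integer times, so finitely many events control every s in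
    [0, t]. *)
Lemma workload_le {R : realType} {T : Type} (xi : int -> T -> R) (U : T -> R) (t : R)
    (r0 : nat) (w : T) (a b : R) :
  0 <= U w <= 1 -> 0 <= t ->
  (ecard [set k | early xi (Num.truncn t).+1 k w] <= a%:E)%E ->
  (forall m, (m <= Num.truncn t)%N -> (ecard [set r | late xi m r0 r w] <= b%:E)%E) ->
  (arrivals xi U t w < +oo)%E /\ (workloade xi U t w <= (a + b + (r0%:R + 2))%:E)%E.
Proof.
move=> U01 t0 ea lb.
have win s : 0 <= s -> s <= t ->
    (ecard [set j | (s < arrival_time xi U j w <= t)%R] - (t - s)%:E <=
     (a + b + (r0%:R + 2))%:E)%E.
  move=> s0 st; apply: le_trans (window_le xi U s t r0 w U01 s0 st) _.
  by rewrite !EFinD leeD2r // leeD // lb //; exact: le_truncn.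
(* The window starting at s = 0 contains all arrivals counted by N(t), so its bound also gives
   finiteness. *)
have fin : (arrivals xi U t w < +oo)%E.
  have := win 0 (lexx _) t0; rewrite arrivals_ecard.
  by case: (ecard _) => [x| |] //=; rewrite ltry.
split=> //; apply: ub_ereal_sup => _ [s /= s0t <-]; move: s0t; rewrite in_itv /= => /andP[s0 st].
by rewrite increment_ecard //; exact: win.
Qed.

Lemma workloade_ge0 {R : realType} {T : Type} (xi : int -> T -> R) (U : T -> R) (t : R) (w : T) :
  0 <= t -> (arrivals xi U t w < +oo)%E -> (0 <= workloade xi U t w)%E.
Proof.
move=> t0 fin; apply: ereal_sup_ubound; exists t; first by rewrite /= in_itv /= t0 lexx.
have := arrivals_ge0 xi U t w; case: (arrivals xi U t w) fin => //= x _ _.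
by congr (_%:E); rewrite subrr.
Qed.

(** The supremum is bounded below by its term at s = a, the end of a block of n late customers. *)
Lemma workloade_ge {R : realType} {T : Type} (xi : int -> T -> R) (U : T -> R) (t : R)
    (a n r0 : nat) (w : T) (e b : R) :
  0 <= U w <= 1 -> a%:R <= t -> (arrivals xi U t w < +oo)%E ->
  (forall j : int, a%:Z - n%:Z <= j < a%:Z -> n%:R < xi j w) ->
  (ecard [set k | early xi a k w] <= e%:E)%E ->
  (ecard [set r | late xi (Num.truncn t) r0 r w] <= b%:E)%E ->
  ((n%:R - e - b - (r0%:R + 1))%:E <= workloade xi U t w)%E.
Proof.
move=> U01 at_ fin big ee lb.
have wg := window_ge xi U t a n r0 w U01 at_ big.
apply: (@le_trans _ _ ((arrivals xi U t w - t%:E) - (arrivals xi U a%:R w - a%:R%:E))%E); last first.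
  by apply: ereal_sup_ubound; exists a%:R => //=; rewrite in_itv /= at_ andbT.
rewrite increment_ecard //.
have := @ecard_ge0 R _ [set k | early xi a k w].
have := @ecard_ge0 R _ [set r | late xi (Num.truncn t) r0 r w].
have := @ecard_ge0 R _ [set j | a%:R < arrival_time xi U j w <= t].
move: wg ee lb; case: (ecard [set j | _]) => [x| |]; case: (ecard [set k | _]) => [y| |];
  case: (ecard [set r | _]) => [z| |] //=; rewrite ?leey // !lee_fin; lra.
Qed.

(** * Right-continuity of the counting process *)

Lemma seq_gap {R : realType} (s t : R) (l : seq R) : s < t -> (forall x, x \in l -> s < x) ->
  exists2 b, s < b <= t & forall x, x \in l -> b <= x.
Proof.
move=> st; elim: l => [|y l IH] H; first by exists t; rewrite ?st ?lexx.
have [x xl|b /andP[sb bt] bl] := IH; first by apply: H; rewrite inE xl orbT.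
exists (Num.min b y).
  by rewrite lt_min sb H ?inE ?eqxx //= ge_min bt.
move=> x; rewrite inE => /orP[/eqP ->|/bl bx]; first by rewrite ge_min lexx orbT.
by rewrite ge_min bx.
Qed.

(** Finitely many arrivals in (s, t] leave a gap to the right of s, and a rational in this gap has
    the same count. *)
Lemma arrivals_right {R : realType} {T : Type} (xi : int -> T -> R) (U : T -> R) (s t : R) (w : T) :
  0 <= s -> s < t -> (arrivals xi U t w < +oo)%E ->
  exists2 q : rat, s < ratr q <= t & arrivals xi U (ratr q) w = arrivals xi U s w.
Proof.
move=> s0 st fin.
have finQ : finite_set [set j | s < arrival_time xi U j w <= t].
  apply: (@ecard_finite R); apply: le_lt_trans fin; rewrite arrivals_ecard.
  by apply: le_ecard => j /= /andP[sj ->]; rewrite (le_lt_trans s0).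
have [|b /andP[sb bt] bA] := @seq_gap _ s t
    (map (fun j => arrival_time xi U j w)
      (finmap.enum_fset (fset_set [set j | s < arrival_time xi U j w <= t]))) st.
  move=> x /mapP[j]; rewrite in_fset_set // inE /= => /andP[sj _] ->; exact: sj.
have [q] := rat_in_itvoo sb; rewrite in_itv /= => /andP[sq qb].
exists q; first by rewrite sq (ltW (lt_le_trans qb bt)).
rewrite (arrivals_split xi U s (ratr q)) ?(ltW sq) //.
rewrite (_ : [set j | _] = set0); first by rewrite /ecard esum_set0 adde0.
rewrite -subset0 => j /= /andP[sj jq].
have : b <= arrival_time xi U j w.
  apply: bA; apply/mapP; exists j => //; rewrite in_fset_set // inE /= sj.
  by rewrite (le_trans jq) // (ltW (lt_le_trans qb bt)).
by rewrite leNgt (le_lt_trans jq qb).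
Qed.

Lemma arrivals0 {R : realType} {T : Type} (xi : int -> T -> R) (U : T -> R) (w : T) :
  arrivals xi U 0 w = 0%E.
Proof.
rewrite arrivals_ecard (_ : [set j | _] = set0); first by rewrite /ecard esum_set0.
by rewrite -subset0 => j /= /andP[]; rewrite ltNge => /negP.
Qed.

(** * Measurability of the workload *)

Lemma nat_int_bij : exists g : nat -> int, set_bij [set: nat] [set: int] g.
Proof.
exists (fun k => if odd k then Negz k./2 else Posz k./2); split=> //.
  move=> k k' _ _ /= E; rewrite -(odd_double_half k) -(odd_double_half k').
  by move: E; case: (odd k); case: (odd k') => // -[->].
move=> [n|n] _; [exists n.*2|exists n.*2.+1] => //=.
  by rewrite odd_double doubleK.
by rewrite odd_double /= uphalf_double.
Qed.

Lemma measurable_arrivals {R : realType} {d : measure_display} {T : measurableType d}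
    (xi : int -> T -> R) (U : T -> R) (t : R) :
  (forall j, measurable_fun [set: T] (xi j)) -> measurable_fun [set: T] U ->
  measurable_fun [set: T] (arrivals xi U t).
Proof.
move=> mxi mU; have [g [_ ginj gsurj]] := nat_int_bij.
rewrite (_ : arrivals xi U t =
    (fun w => ecard [set k | (arrival_time xi U (g k) @^-1` `]0, t]) w] : \bar R)).
  apply: measurable_ecard => k; rewrite -[X in measurable X]setTI.
  apply: (_ : measurable_fun [set: T] (arrival_time xi U (g k))) => //.
  by apply: measurable_funD => //; apply: measurable_funD.
apply/funext => w; rewrite arrivals_ecard; apply: (ecard_bij _ _ g); split.
- by move=> k /=; rewrite in_itv.
- by move=> k k' _ _; apply: ginj; rewrite inE.
- move=> j jA; have [k _ kj] := gsurj j I.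
  by exists k => //=; rewrite in_itv /= kj.
Qed.

(** The supremum reduces to a countable one, over t and the rationals of [0, t]: moving s to the
    right, to a rational q with N(q) = N(s), only increases the term, since s enters it with a plus
    sign. *)
Lemma measurable_workload {R : realType} {d : measure_display} {T : measurableType d}
    (xi : int -> T -> R) (U : T -> R) (t : R) : 0 <= t ->
  (forall j, measurable_fun [set: T] (xi j)) -> measurable_fun [set: T] U ->
  measurable_fun [set: T] (workload xi U t).
Proof.
move=> t0 mxi mU; have mA s := measurable_arrivals xi U s mxi mU.
(* Enumerates the rationals of [0, t]; any other code gives the default value t, so that s = t is
   covered even for irrational t. *)
pose p (n : nat) : R :=
  if unpickle n is Some q then if (0 <= ratr q :> R) && (ratr q <= t) then ratr q else t else t.
have p0t n : 0 <= p n <= t.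
  rewrite /p; case: (unpickle n) => [q|]; last by rewrite t0 lexx.
  by case: ifP => // _; rewrite t0 lexx.
have pq (q : rat) : (0 <= ratr q :> R) && (ratr q <= t) -> exists n, p n = ratr q.
  by move=> qt; exists (pickle q); rewrite /p pickleK qt.
pose f n w := ((arrivals xi U t w - t%:E) - (arrivals xi U (p n) w - (p n)%:E))%E.
have mf n : measurable_fun [set: T] (f n).
  by do !apply: emeasurable_funB => //.
suff -> : workload xi U t = fine \o (fun w => esups (f ^~ w) 0%N).
  apply: (measurableT_comp (@fine_measurable R setT measurableT)).
  exact: measurable_fun_esups.
apply/funext => w; rewrite /workload /=; congr fine.
apply/eqP; rewrite eq_le; apply/andP; split; last first.
  apply: le_ereal_sup => _ [n _ <-]; exists (p n) => //=.
  by rewrite in_itv /= p0t.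
apply: ub_ereal_sup => _ [s /= + <-]; rewrite in_itv /= => /andP[s0 st].
have sup n : (f n w <= ereal_sup (sdrop (f ^~ w) 0))%E.
  by apply: ereal_sup_ubound; exists n.
have [ts|ts] := leP t s.
  have -> : s = t by apply/eqP; rewrite eq_le st ts.
  have [n pn] : exists n, p n = t.
    (* The number -1 is outside [0, t], so its code takes the default value. *)
    exists (pickle (-1 : rat)); rewrite /p pickleK rmorphN rmorph1.
    by rewrite ifF // lerNr oppr0 ler10.
  by apply: le_trans (sup n); rewrite /f pn.
have [fin|] := ltP (arrivals xi U t w) +oo%E.
  have [q /andP[sq qt] Aq] := arrivals_right xi U s t w s0 ts fin.
  have [n pn] : exists n, p n = ratr q by apply: pq; rewrite qt (ltW (le_lt_trans s0 sq)).
  apply: le_trans (sup n); rewrite /f pn Aq; apply: leeB => //.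
  by apply: leeD => //; rewrite lee_fin lerN2 ltW.
rewrite leye_eq => /eqP Aoo.
(* When N(t) is infinite, the term at s = 0 is already +oo, because N(0) = 0. *)
have [n pn] : exists n, p n = 0.
  by have [] := pq 0; rewrite rmorph0 ?lexx // => n pn; exists n.
apply: le_trans (sup n); rewrite /f pn arrivals0 Aoo.
by rewrite /= subr0 leey.
Qed.

(** * Power tails *)

(** Comparison with the integral of u^(-alpha) over [x, x + 1], obtained without integration from
    ln((x + 1) / x) >= 1 / (x + 1) and exp(y) >= 1 + y. *)
Lemma powR_telescope {R : realType} (alpha x : R) : 1 < alpha -> 0 < x ->
  (x + 1) `^ (- alpha) <= (x `^ (1 - alpha) - (x + 1) `^ (1 - alpha)) / (alpha - 1).
Proof.
move=> a1 x0; have y0 : 0 < x + 1 by rewrite addr_gt0.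
rewrite ler_pdivlMr ?subr_gt0 // lerBrDr.
have yE : (x + 1) `^ (- alpha) = (x + 1) `^ (1 - alpha) / (x + 1).
  by rewrite powRD ?powRr1 ?(ltW y0) ?(gt_eqF y0) ?implybT // mulrC mulKf // gt_eqF.
have lnxy : 1 / (x + 1) <= ln (x + 1) - ln x.
  rewrite -ln_div ?posrE //.
  have : ln (x / (x + 1)) <= x / (x + 1) - 1.
    have -> : x / (x + 1) = 1 + (x / (x + 1) - 1) by ring.
    apply: le_trans (le_ln1Dx _) _; last lra.
    by rewrite -subr_gt0 opprK subrK divr_gt0.
  rewrite !ln_div ?posrE // => H.
  have : x / (x + 1) - 1 = - (1 / (x + 1)) by field; rewrite gt_eqF.
  by move: H; lra.
have -> : x `^ (1 - alpha) = (x + 1) `^ (1 - alpha) * expR ((alpha - 1) * (ln (x + 1) - ln x)).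
  rewrite /powR !gt_eqF // -expRD; congr expR; ring.
rewrite yE; set Z := (x + 1) `^ _.
have -> : Z / (x + 1) * (alpha - 1) + Z = Z * (1 + (alpha - 1) * (1 / (x + 1))) by ring.
rewrite ler_wpM2l ?powR_ge0 //; apply: le_trans (expR_ge1Dx _).
by rewrite lerD2l ler_wpM2l // subr_ge0 ltW.
Qed.

Lemma powR_tail_sum {R : realType} (alpha : R) (N : nat) : 1 < alpha -> (0 < N)%N ->
  (\sum_(k <oo) ((N.+1 + k)%:R `^ (- alpha))%:E <= (N%:R `^ (1 - alpha) / (alpha - 1))%:E)%E.
Proof.
move=> a1 N0; apply: lime_le.
  by apply: is_cvg_nneseries => k _ _; rewrite lee_fin powR_ge0.
apply: nearW => K; rewrite sumEFin lee_fin big_mkord.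
(* Keeping the subtracted power makes the induction telescope. *)
suff : \sum_(k < K) (N.+1 + k)%:R `^ (- alpha) <=
    (N%:R `^ (1 - alpha) - (N + K)%:R `^ (1 - alpha)) / (alpha - 1).
  move=> /le_trans; apply; rewrite ler_pM2r ?invr_gt0 ?subr_gt0 // gerBl.
  exact: powR_ge0.
elim: K => [|K IH]; first by rewrite big_ord0 addn0 subrr mul0r.
rewrite big_ord_recr /=; apply: le_trans (lerD IH (lexx _)) _.
have := @powR_telescope R alpha (N + K)%:R a1 _.
rewrite ltr0n addn_gt0 N0 /= natr1 => /(_ isT).
rewrite addSn addnS !mulrBl; lra.
Qed.

(** The ratio is eventually within 1/2 of its limit; the constant factors lost are harmless on the
    scale log t / log log t. *)
Lemma tail_bounds {R : realType} (c alpha : R) (p : R -> R) : 0 < c ->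
  p x / (c * x `^ (- alpha)) @[x --> +oo] --> (1 : R) ->
  exists2 x0, 0 < x0 & forall x, x0 <= x ->
    (c / 2) * x `^ (- alpha) <= p x <= (2 * c) * x `^ (- alpha).
Proof.
move=> c0 /cvgrPdist_le /(_ (1 / 2)) []; first by rewrite divr_gt0.
move=> M [_ MH]; exists (Num.max M 0 + 1).
  by rewrite ltr_pwDr // le_max lexx orbT.
move=> x Mx; have xM : M < x.
  by apply: lt_le_trans Mx; rewrite ltr_pwDr // le_max lexx.
have x0 : 0 < x by apply: lt_le_trans Mx; rewrite ltr_pwDr // le_max lexx orbT.
have D0 : 0 < c * x `^ (- alpha) by rewrite mulr_gt0 // powR_gt0.
have := MH x xM; rewrite ler_distlC => /andP[].
rewrite ler_pdivlMr // ler_pdivrMr // => H1 H2; apply/andP; split; lra.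
Qed.

(** * Consequences of mutual independence *)

Lemma mutually_independent_inj {R : realType} {d : measure_display} {T : measurableType d}
    (P : probability T R) (X : int -> {RV P >-> R}) (j : nat -> int) (C : nat -> set R)
    (s : seq nat) :
  mutually_independent X -> injective j -> (forall r, measurable (C r)) -> uniq s ->
  (P (\bigcap_(r in [set` s]) (X (j r) @^-1` C r)) =
   \prod_(r <- s) P (X (j r) @^-1` C r))%E.
Proof.
move=> indX jinj mC us.
(* Transports the sets C r along j without an inverse of j: B (j r) = C r by injectivity, and B i is
   the whole line off the range of j. *)
pose B i := \bigcap_(r in [set r | j r = i]) C r.
have BC r : B (j r) = C r.
  apply/seteqP; split => x; first by apply.
  by move=> Cx r' /= /jinj ->.
have mB i : measurable (B i) by apply: bigcap_measurableType => r _; exact: mC.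
have := indX (map j s) B; rewrite map_inj_uniq // big_map => /(_ us mB).
rewrite bigcap_seq big_map -bigcap_seq.
under eq_bigcapr do rewrite BC.
by under eq_bigr do rewrite BC.
Qed.

Lemma bigcap_allpairs {T : Type} (I J K : choiceType) (f : I -> J -> K) (s : seq I) (t : seq J) 
    (F : K -> set T) :
  \bigcap_(k in [set` [seq f i j | i <- s, j <- t]]) F k =
  \bigcap_(i in [set` s]) \bigcap_(k in [set` [seq f i j | j <- t]]) F k.
Proof.
rewrite !bigcap_seq big_allpairs_dep; apply: eq_bigr => i _.
by rewrite bigcap_seq big_map.
Qed.

(** The block ends just before time (i + 1) n, and displacements above n make all its customers late
    at that time. *)
Definition block (n i : nat) : seq int := [seq (i * n + k)%N%:Z | k <- iota 0 n].

Lemma mem_block (n i : nat) (j : int) :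
  (j \in block n i) = ((i * n)%:Z <= j < (i.+1 * n)%:Z).
Proof.
apply/mapP/idP => [[k]|/andP[j1 j2]].
  by rewrite mem_iota add0n => /andP[_ kn] ->; apply/andP; split; lia.
by exists (absz (j - (i * n)%:Z)%R); [rewrite mem_iota; lia|lia].
Qed.

Lemma uniq_blocks (n : nat) (s : seq nat) :
  uniq s -> uniq [seq (i * n + k)%N%:Z | i <- s, k <- iota 0 n].
Proof.
move=> us; apply: allpairs_uniq => //; first exact: iota_uniq.
move=> [i k] [i' k'] /allpairsP[[x y] /= [_ ]]; rewrite mem_iota add0n => /andP[_ yn] [-> ->].
move=> /allpairsP[[x' y'] /= [_ ]]; rewrite mem_iota add0n => /andP[_ yn'] [-> ->] /= [E].
have n0 : (0 < n)%N by exact: leq_ltn_trans yn.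
have xx : x = x'.
  by have := congr1 (divn^~ n) E; rewrite /= !divnMDl // !divn_small // !addn0.
by move: E; rewrite xx => /addnI ->.
Qed.


Lemma mutually_independent_blocks {R : realType} {d : measure_display} {T : measurableType d}
    (P : probability T R) (X : int -> {RV P >-> R}) (n : nat) (B : set R) (q : R) (s : seq nat) :
  mutually_independent X -> measurable B -> (forall j, P (X j @^-1` B) = q%:E) -> uniq s ->
  P (\bigcap_(i in [set` s]) \bigcap_(j in [set` block n i]) (X j @^-1` B)) = ((q ^+ n) ^+ size s)%:E.
Proof.
move=> indX mB qE us; rewrite -bigcap_allpairs (indX _ (fun=> B)) //; last exact: uniq_blocks.
under eq_bigr do rewrite qE.
by rewrite prodEFin big_const_seq count_predT iter_mulr mulr1 size_allpairs size_iota mulnC exprM.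
Qed.

(** Customer j0 comes after all the blocks considered, so it is a new index and mutual independence
    applies to the enlarged list. *)
Lemma mutually_independent_blocks_after {R : realType} {d : measure_display} {T : measurableType d}
    (P : probability T R) (X : int -> {RV P >-> R}) (n a : nat) (j0 : int) 
    (B C : set R) (q : R) (s : seq nat) :
  mutually_independent X -> measurable B -> measurable C -> (forall j, P (X j @^-1` B) = q%:E) ->
  uniq s -> all (fun i => i < a)%N s -> (a * n)%:Z <= j0 ->
  (P (X j0 @^-1` C `&` \bigcap_(i in [set` s]) \bigcap_(j in [set` block n i]) (X j @^-1` B)) =
  P (X j0 @^-1` C) * ((q ^+ n) ^+ size s)%:E)%E.
Proof.
move=> indX mB mC qE us sa aj.
rewrite -(mutually_independent_blocks P X n B q s) // -bigcap_allpairs.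
set l := [seq _ | i <- s, k <- _].
have j0l : j0 \notin l.
  apply/negP => /allpairsP[[i k] /= [is_ + jE]]; rewrite mem_iota add0n => /andP[_ kn].
  have ia := allP sa i is_; move: aj; rewrite jE; nia.
pose D j := if j == j0 then C else B.
have mD j : measurable (D j) by rewrite /D; case: ifP.
have ul : uniq l by exact: uniq_blocks.
have ul0 : uniq (j0 :: l) by rewrite /= j0l.
have := indX (j0 :: l) D ul0 mD; rewrite bigcap_cons big_cons.
have -> : \bigcap_(i in [set` l]) (X i @^-1` D i) = \bigcap_(i in [set` l]) (X i @^-1` B).
  apply: eq_bigcapr => j /= jl; rewrite /D ifF //; apply/negP => /eqP jj.
  by move: j0l; rewrite -jj jl.
rewrite {1 2}/D eqxx => ->; congr (_ * _)%E.
rewrite (indX l (fun=> B)) // big_seq [RHS]big_seq; apply: eq_bigr => j jl.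
by rewrite /D ifF //; apply/negP => /eqP jj; move: j0l; rewrite -jj jl.
Qed.

(** * Concentration of the workload *)

Lemma identically_distributedE {R : realType} {d : measure_display} {T : measurableType d}
    (P : probability T R) (X : int -> {RV P >-> R}) (j : int) (B : set R) :
  identically_distributed X -> measurable B -> P (X j @^-1` B) = P (X 0 @^-1` B).
Proof. by move=> idX mB; exact: (idX j 0). Qed.

Lemma measurable_late {R : realType} {d : measure_display} {T : measurableType d}
    (P : probability T R) (X : int -> {RV P >-> R}) (m r0 r : nat) :
  measurable (late (fun j => X j) m r0 r).
Proof. by rewrite /late -[X in measurable X]setTI; exact: measurable_funP. Qed.

Lemma measurable_early {R : realType} {d : measure_display} {T : measurableType d}
    (P : probability T R) (X : int -> {RV P >-> R}) (a k : nat) :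
  measurable (early (fun j => X j) a k).
Proof. by rewrite /early -[X in measurable X]setTI; exact: measurable_funP. Qed.

(** The sum of P(xi_0 <= -k) is the mean number of integers k >= 0 with k <= -xi_0, hence at most 1
    plus the mean of the negative part. Identical distribution makes the bound uniform in a. *)
Lemma early_sum {R : realType} {d : measure_display} {T : measurableType d}
    (P : probability T R) (X : int -> {RV P >-> R}) : identically_distributed X ->
  ('E_P[(fun w => Num.max (- X 0 w) 0)%R] < +oo)%E ->
  exists2 S : R, 0 <= S & forall a, (\sum_(k <oo) P (early (fun j => X j) a k) <= S%:E)%E.
Proof.
move=> idX EX; pose Y w : R := Num.max (- X 0 w) 0; rewrite -[fun w => _]/Y in EX.
have mY : measurable_fun [set: T] Y.
  apply: measurable_maxr => //; apply: measurableT_comp => //.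
have Y0 w : 0 <= Y w by rewrite /Y le_max lexx orbT.
have EX0 : (0 <= 'E_P[Y])%E by rewrite unlock; apply: integral_ge0 => w _; rewrite lee_fin.
have EXf : ('E_P[Y] = (fine 'E_P[Y])%:E)%E by rewrite fineK // ge0_fin_numE.
exists (1 + fine 'E_P[Y]); first by rewrite addr_ge0 // fine_ge0.
move=> a; pose F k := X 0 @^-1` `]-oo, - k%:R].
have mF k : measurable (F k) by rewrite -[F k]setTI; exact: measurable_funP.
rewrite (eq_eseriesr (g := fun k => P (F k `&` setT))); last first.
  by move=> k _; rewrite setIT /early identically_distributedE.
rewrite -integral_ecard //.
apply: (@le_trans _ _ (\int[P]_w (1 + (Y w)%:E))%E).
  apply: ge0_le_integral => //.
  - by move=> w _; exact: ecard_ge0.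
  - exact: measurable_ecard.
  - by apply: emeasurable_funD => //; exact/measurable_EFinP.
  - move=> w _; rewrite -EFinD.
    apply: (@le_trans _ _ (Num.truncn (Y w)).+1%:R%:E); last first.
      by rewrite lee_fin -natr1 addrC lerD2l truncn_le.
    rewrite -ecard_II; apply: le_ecard => k /=; rewrite /F /= in_itv /= => Xk.
    rewrite ltnS truncn_ge_nat //.
    by rewrite /Y le_max lerNr Xk.
rewrite ge0_integralD //; last exact/measurable_EFinP.
rewrite integral_cst // mul1e EFinD; apply: leeD; first exact: probability_le1.
  by rewrite -EXf unlock.
by move=> w _; rewrite lee_fin.
Qed.

(** Once the last N + 1 customers are left out, the mean number of late ones is O(N^(1 - alpha)),
    uniformly in m. *)
Lemma late_sum {R : realType} {d : measure_display} {T : measurableType d}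
    (P : probability T R) (X : int -> {RV P >-> R}) (C alpha x0 : R) (m N : nat) :
  identically_distributed X -> 0 <= C -> 1 < alpha ->
  (forall x, x0 <= x -> fine (ccdf (X 0) x) <= C * x `^ (- alpha)) ->
  (0 < N)%N -> x0 <= N%:R ->
  (\sum_(k <oo) P (late (fun j => X j) m N.+1 k) <= (C * (N%:R `^ (1 - alpha) / (alpha - 1)))%:E)%E.
Proof.
move=> idX C0 a1 tail N0 xN.
rewrite EFinM; apply: le_trans (lee_wpmul2l _ (powR_tail_sum alpha N a1 N0)); rewrite ?lee_fin //.
rewrite -nneseriesZl; last by move=> k _; rewrite lee_fin powR_ge0.
apply: lee_nneseries => [k _ _|k _]; first exact: measure_ge0.
rewrite /late identically_distributedE // -EFinM.
have -> : P (X 0 @^-1` `](N.+1 + k)%:R, +oo[) = (fine (ccdf (X 0) (N.+1 + k)%:R))%:E.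
  by rewrite fineK // fin_num_measure.
by rewrite lee_fin; apply: tail; apply: le_trans xN _; rewrite ler_nat; lia.
Qed.

Lemma uniform01_outside {R : realType} {d : measure_display} {T : measurableType d}
    (P : probability T R) (U : {RV P >-> R}) : uniform01 U ->
  P (U @^-1` ~` `[0, 1]) = 0%E.
Proof.
move=> /(_ (~` `[0, 1]) (measurableC (measurable_itv _))) unifU.
have -> : P (U @^-1` ~` `[0, 1]) = distribution P U (~` `[0, 1]) by [].
rewrite unifU /uniform_prob; apply: integral0_eq => x /= /negP.
by rewrite in_itv /= /uniform_pdf => /negbTE ->.
Qed.

Lemma measureU_le {R : realType} {d : measure_display} {T : measurableType d}
    (P : probability T R) (A B : set T) (a b : R) :
  measurable A -> measurable B -> (P A <= a%:E)%E -> (P B <= b%:E)%E ->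
  (P (A `|` B) <= (a + b)%:E)%E.
Proof.
move=> mA mB Aa Bb; apply: le_trans (measureU2 P mA mB) _.
by rewrite EFinD; apply: leeD.
Qed.

(** Non-asymptotic form of the result, with parameters to be tuned: p bounds the late counts at all
    integer times up to t, e bounds the counts at t and the early count at the end of a block, n is
    the block length, N a number of blocks ending by time t. *)
Lemma workload_concentration {R : realType} {d : measure_display} {T : measurableType d}
    (P : probability T R) (xi : int -> {RV P >-> R}) (U : {RV P >-> R})
    (t e mu S q : R) (r0 p n N : nat) :
  iid xi -> uniform01 U -> 0 <= t -> 0 < e -> 0 < mu -> 0 <= S -> (0 < p)%N ->
  (forall m, \sum_(k <oo) P (late (fun j => xi j) m r0 k) <= mu%:E)%E ->
  (forall a, \sum_(k <oo) P (early (fun j => xi j) a k) <= S%:E)%E ->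
  ccdf (xi 0) n%:R = q%:E -> (N * n)%:R <= t ->
  exists B : set T, [/\ measurable B,
    (P B <= ((Num.truncn t).+1%:R * (expR 1 * mu / p%:R) ^+ p +
             (S / e + mu / e + ((1 - q ^+ n) ^+ N + S / e)))%:E)%E &
    forall w, ~ B w ->
      n%:R - e - e - (r0%:R + 1) <= workload (fun j => xi j) U t w <= e + p%:R + (r0%:R + 2)].
Proof.
move=> [indxi idxi] unifU t0 e0 mu0 S0 p0 lmu eS qE Nt.
set t1 := Num.truncn t; pose X := fun j => xi j : T -> R.
have mX j : measurable_fun [set: T] (X j) by exact: measurable_funP.
have mL (F : nat -> set T) (M : R) : (forall k, measurable (F k)) ->
    measurable [set w | M%:E <= (ecard [set k | F k w] : \bar R)]%E.
  move=> mF; rewrite -[X in measurable X]setTI; apply: (emeasurable_fun_c_infty measurableT).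
  exact: measurable_ecard.
have ml m r := measurable_late P xi m r0 r; have me := measurable_early P xi.
pose L m := [set w | p%:R%:E <= (ecard [set k | late X m r0 k w] : \bar R)]%E.
(* [B1]: too many late customers at some integer time, handled by Chernoff bounds and a union bound.
   For [B2] and [B3], which concern time t only, Markov's inequality suffices. *)
pose B1 := \big[setU/set0]_(m < t1.+1) L m.
pose B2 := [set w | e%:E <= (ecard [set k | early X t1.+1 k w] : \bar R)]%E.
pose B3 := [set w | e%:E <= (ecard [set k | late X t1 r0 k w] : \bar R)]%E.
pose E i := \bigcap_(j in [set` block n i]) (xi j @^-1` `]n%:R, +oo[).
have mxi j (C : set R) : measurable C -> measurable (xi j @^-1` C).
  by move=> mC; rewrite -[X in measurable X]setTI; exact: measurable_funP.
have mE i : measurable (E i) by apply: fin_bigcap_measurable => // j _; exact: mxi.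
(* No block among the first N has both all displacements above n and fewer than e early customers at
   its end. *)
pose B4 := \bigcap_(i in `I_N) (~` E i `|`
  [set w | e%:E <= (ecard [set k | early X (i.+1 * n) k w] : \bar R)]%E).
pose B0 := U @^-1` ~` `[0, 1].
have mB0 : measurable B0.
  rewrite -[B0]setTI; have := @measurable_funP _ _ _ _ _ U; apply => //.
  exact: measurableC.
have mLm m : measurable (L m) by apply: mL.
have mB1 : measurable B1 by exact: bigsetU_measurable.
have mB2 : measurable B2 by apply: mL.
have mB3 : measurable B3 by apply: mL.
have mB4 : measurable B4.
  apply: bigcap_measurableType => i _; apply: measurableU; first exact: measurableC.
  by apply: mL.
have qX j : P (xi j @^-1` `]n%:R, +oo[) = q%:E.
  by rewrite identically_distributedE.
have q01 : 0 <= q <= 1.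
  by rewrite -!lee_fin -(qX 0) measure_ge0 probability_le1 //; exact: mxi.
have PB0 : P B0 = 0%E by exact: uniform01_outside.
have PB1 : (P B1 <= (t1.+1%:R * (expR 1 * mu / p%:R) ^+ p)%:E)%E.
  apply: (@le_trans _ _ (\sum_(m < t1.+1) P (L m))%E).
    by apply: (@Boole_inequality _ _ _ P L) => i _; exact: mLm.
  apply: (@le_trans _ _ (\sum_(m < t1.+1) ((expR 1 * mu / p%:R) ^+ p)%:E)%E).
    apply: lee_sum => m _; apply: chernoff_ecard => // s us.
    apply: (mutually_independent_inj P xi (fun r => m%:Z - (r0 + r).+1%:Z)
      (fun r => `](r0 + r)%:R, +oo[%classic)) => //.
    by move=> r r'; lia.
  by rewrite sumEFin lee_fin sumr_const card_ord mulr_natl.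
have PB2 : (P B2 <= (S / e)%:E)%E by apply: markov_ecardT.
have PB3 : (P B3 <= (mu / e)%:E)%E by apply: markov_ecardT.
have PB4 : (P B4 <= ((1 - q ^+ n) ^+ N + S / e)%:E)%E.
  have /andP[q0 q1] := q01.
  apply: first_success_bound => //.
  - by move=> s us; apply: mutually_independent_blocks.
  - move=> i k s us si.
    (* Customers early at the end of block i are numbered from (i + 1) n on, so they lie outside
       blocks 0 to i. *)
    apply: (mutually_independent_blocks_after P xi n i.+1 ((i.+1 * n)%:Z + k%:Z)
      `]n%:R, +oo[%classic `]-oo, - k%:R]%classic q s) => //.
    by rewrite lerDl.
  - by rewrite exprn_ge0.
  - by rewrite exprn_ile1.
exists (B0 `|` (B1 `|` (B2 `|` B3 `|` B4))); split.
- by do !apply: measurableU.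
- rewrite -[X in X%:E]add0r; apply: measureU_le => //; [by do !apply: measurableU|by rewrite PB0|].
  apply: measureU_le => //; first by do !apply: measurableU.
  apply: measureU_le => //; first exact: measurableU.
  exact: measureU_le.
move=> w nB.
have U01 : 0 <= U w <= 1.
  by apply: contrapT => nU; apply: nB; left; rewrite /B0 /= in_itv.
have lb m : (m <= t1)%N -> (ecard [set r | late X m r0 r w] <= p%:R%:E :> \bar R)%E.
  move=> mt; rewrite leNgt; apply/negP => /ltW pl; apply: nB; right; left.
  by rewrite /B1 -(bigcup_mkord t1.+1 L); exists m; [rewrite /= ltnS|exact: pl].
have eb : (ecard [set k | early X t1.+1 k w] <= e%:E)%E.
  rewrite leNgt; apply/negP => /ltW pl; apply: nB; right; right; left; left; exact: pl.
have lb3 : (ecard [set r | late X t1 r0 r w] <= e%:E)%E.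
  rewrite leNgt; apply/negP => /ltW pl; apply: nB; right; right; left; right; exact: pl.
have [fin wle] := workload_le X U t r0 w e p%:R U01 t0 eb lb.
have wge0 := workloade_ge0 X U t w t0 fin.
have [i [iN Ei ei]] : exists i, [/\ (i < N)%N, E i w &
    (ecard [set k | early X (i.+1 * n) k w] <= e%:E)%E].
  have nB4 : ~ B4 w by move=> b4; apply: nB; right; right; right.
  apply: contrapT => ne; apply: nB4 => i /= iN.
  have [Ei|] := pselect (E i w); last by left.
  right=> /=; rewrite leNgt; apply/negP => /ltW ei; apply: ne; by exists i.
have at_ : (i.+1 * n)%:R <= t by apply: le_trans Nt; rewrite ler_nat leq_mul2r iN orbT.
have wge := workloade_ge X U t (i.+1 * n) n r0 w e e U01 at_ fin _ ei lb3.
have {}wge : ((n%:R - e - e - (r0%:R + 1))%:E <= workloade X U t w)%E.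
  apply: wge => j jn; have := Ei j; rewrite /= mem_block in_itv /= andbT; apply.
  by move: jn; rewrite {1}mulSn PoszD addrAC subrr add0r.
(* [workloade] lies between two reals, so [fine] returns its actual value. *)
rewrite /workload -/X; move: wge0 wge wle; case: (workloade X U t w) => [x| |] //=.
by rewrite !lee_fin => _ -> ->.
Qed.

(** * Convergence to a constant and asymptotics in log t / log log t *)

(** Convergence in probability to a constant suffices: f (X t) is within e / 2 of f a off B, and
    within 2 M on B, where M bounds f. Any measurable B covering the exceptional set is allowed, so
    explicit bad events can be used. *)
Lemma cvg_in_distribution_dirac {R : realType} {d : measure_display} {T : measurableType d}
    (P : probability T R) (X : R -> T -> R) (a : R) :
  (\forall t \near +oo, measurable_fun [set: T] (X t)) ->
  (forall eps eta : R, 0 < eps -> 0 < eta -> \forall t \near +oo,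
     exists B : set T, [/\ measurable B, (P B <= eta%:E)%E &
       forall w, ~ B w -> `|X t w - a| <= eps]) ->
  cvg_in_distribution P X (\d_a).
Proof.
move=> mX cX; split=> // f cf bf.
have mf : measurable_fun [set: R] f by exact: continuous_measurable_fun.
rewrite integral_dirac //; last exact/measurable_EFinP.
rewrite diracT mul1e.
have intc (r : R) : (\int[P]_w r%:E = r%:E)%E.
  rewrite integral_cst // [X in (_ * X)%E](_ : _ = 1%E) ?mule1 //.
  exact: probability_setT.
have [M M0 fM] : exists2 M : R, 0 < M & forall x, `|f x| <= M.
  have /ex_strict_bound_gt0 [M M0 fM] := bf.
  by exists M => // x; exact/ltW/fM.
have intf t : measurable_fun [set: T] (X t) -> P.-integrable [set: T] (EFin \o (f \o X t)).
  move=> mXt; apply: measurable_bounded_integrable => //.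
  - by rewrite (le_lt_trans (probability_le1 _ _)) // ltry.
  - exact: measurableT_comp.
  - exists M; split; first by rewrite num_real.
    by move=> y My w _; apply: le_trans (fM _) (ltW My).
apply/fine_cvgP; split.
  by apply: filterS mX => t mXt; rewrite unlock; exact: integrable_fin_num (intf t mXt).
apply/cvgrPdist_le => /= e e0.
have /cvgrPdist_le /(_ (e / 2)) := cf a.
move=> /(_ (divr_gt0 e0 (ltr0Sn _ 1))) [del /= del0 fdel].
(* Halved because continuity is stated on an open ball, whereas the bound off B is not strict. *)
have del20 : 0 < del / 2 by rewrite divr_gt0.
(* Makes 2 M P(B) at most e / 2. *)
have eta0 : 0 < e / (4 * M) by rewrite divr_gt0 // mulr_gt0.
near=> t.
have mXt : measurable_fun [set: T] (X t) by near: t.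
have [B [mB PB XB]] : exists B : set T, [/\ measurable B, (P B <= (e / (4 * M))%:E)%E &
    forall w, ~ B w -> `|X t w - a| <= del / 2] by near: t; exact: cX.
have it := intf t mXt.
have Efin : 'E_P[f \o X t]%E \is a fin_num by rewrite unlock; exact: integrable_fin_num it.
rewrite -lee_fin.
have ica : P.-integrable [set: T] (EFin \o cst (f a)) by exact: finite_measure_integrable_cst.
have EE : ((f a - fine 'E_P[f \o X t])%:E = \int[P]_w ((f a)%:E - (f (X t w))%:E))%E.
  rewrite (integralB_EFin (f1 := cst (f a)) (f2 := f \o X t)) //.
  rewrite [X in (X - _)%E](intc (f a)).
  by rewrite EFinB fineK // unlock.
rewrite -abse_EFin EE.
have mg : measurable_fun [set: T] (fun w => (f a)%:E - (f (X t w))%:E)%E.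
  by apply: emeasurable_funB => //; apply/measurable_EFinP => //; exact: measurableT_comp.
apply: le_trans (le_abse_integral _ _ mg) _ => //.
apply: (@le_trans _ _ (\int[P]_w ((e / 2)%:E + (2 * M)%:E * (\1_B w)%:E))%E).
  apply: ge0_le_integral => //.
  - exact: (measurableT_comp _ mg).
  - by apply: emeasurable_funD => //; apply: emeasurable_funM => //; apply/measurable_EFinP => //; exact: measurable_indic.
  - move=> w _; rewrite -EFinB -EFinM -EFinD lee_fin indicE.
    case: (boolP (w \in B)) => wB; rewrite ?mulr1 ?mulr0 ?addr0.
      apply: le_trans (ler_normB _ _) _.
      by have := fM a; have := fM (X t w); move: e0; lra.
    apply: fdel => /=; rewrite distrC; apply: le_lt_trans (XB w _) _; last lra.
    by move=> Bw; move/negP: wB; apply; exact/mem_set.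
rewrite ge0_integralD //; last first.
- by apply: emeasurable_funM => //; apply/measurable_EFinP => //; exact: measurable_indic.
- by move=> w _; rewrite -EFinM lee_fin mulr_ge0 // mulr_ge0 // ltW.
- by move=> w _; rewrite lee_fin divr_ge0 // ltW.
rewrite intc ge0_integralZl //; last first.
- by rewrite lee_fin mulr_ge0 // ltW.
- by apply/measurable_EFinP; exact: measurable_indic.
rewrite integral_indic // setIT.
apply: (@le_trans _ _ ((e / 2)%:E + (2 * M)%:E * (e / (4 * M))%:E)%E).
  by rewrite leeD2l // lee_wpmul2l // lee_fin mulr_ge0 // ltW.
rewrite -EFinM -EFinD lee_fin le_eqVlt; apply/orP; left; apply/eqP.
by field; rewrite gt_eqF.
Unshelve. all: by end_near.
Qed.

(** The bound ln x < x at x = eta y / 2 uses half of eta y; the other half absorbs ln (2 / eta). *)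
Lemma ln_le_linear {R : realType} (eta y : R) : 0 < eta -> 0 < y ->
  2 / eta * ln (2 / eta) <= y -> ln y <= eta * y.
Proof.
move=> h0 y0 H; have h20 : 0 < 2 / eta by rewrite divr_gt0.
have -> : ln y = ln (eta * y / 2) + ln (2 / eta).
  rewrite -lnM ?posrE ?divr_gt0 ?mulr_gt0 //; congr ln; field; rewrite gt_eqF //.
have lnl : ln (eta * y / 2) < eta * y / 2.
  by apply: ln_sublinear; rewrite divr_gt0 // mulr_gt0.
have : ln (2 / eta) <= eta * y / 2.
  have -> : eta * y / 2 = y / (2 / eta) by field; rewrite gt_eqF.
  by rewrite ler_pdivlMr // mulrC.
by move: lnl; lra.
Qed.

(** With y = ln (ln t), L = exp(y) / y and ln L = y - ln y, so L ln L = (1 - ln y / y) ln t. This is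
    how powers L^(beta L) become t^beta up to a factor t^o(1). *)
Lemma loglog_asymptotics {R : realType} (A eta : R) : 0 < eta ->
  \forall t \near +oo, let L := ln t / ln (ln t) in
    [/\ 1 < t, A <= ln t & 1 <= L] /\
    [/\ A <= L, L <= eta * ln t, (1 - eta) * ln t <= L * ln L & L * ln L <= ln t].
Proof.
move=> eta0.
(* The entries serve, in turn: ln y >= 0; A <= y / 2 <= L; 1 <= y / 2; L <= eta ln t; ln y <= eta
   y. *)
pose Y := Num.max 1 (Num.max (2 * A) (Num.max 2 (Num.max (eta^-1) (2 / eta * ln (2 / eta))))).
near=> t.
have tY : expR (expR (Num.max A Y)) <= t by near: t; apply: nbhs_pinfty_ge; rewrite num_real.
have t0 : 0 < t by apply: lt_le_trans tY; rewrite expR_gt0.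
have lt1 : expR (Num.max A Y) <= ln t.
  by rewrite -ler_expR lnK // posrE.
have lt0 : 0 < ln t by apply: lt_le_trans lt1; rewrite expR_gt0.
have lt2 : Num.max A Y <= ln (ln t) by rewrite -ler_expR lnK // posrE.
set y := ln (ln t) in lt2 *.
have lty : ln t = expR y by rewrite /y lnK.
have [Ay Yy] : A <= y /\ Y <= y by move: lt2; rewrite ge_max => /andP[].
have : [/\ 1 <= y, 2 * A <= y, 2 <= y, eta^-1 <= y & 2 / eta * ln (2 / eta) <= y].
  by move: Yy; rewrite /Y !ge_max => /andP[-> /andP[-> /andP[-> /andP[-> ->]]]].
move=> [y1 y2A y2 yeta yln]; set L := ln t / y.
have y0 : 0 < y by exact: lt_le_trans y1.
(* The quadratic term gives L >= y / 2. *)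
have ey : 1 + y ^+ 2 / 2 <= expR y by have := @expR_ge1Dxn R y 1 (ltW y0).
have LE : L = expR y / y by rewrite /L lty.
have L0 : 0 < L by rewrite LE divr_gt0 // expR_gt0.
have Ly2 : y / 2 <= L.
  by rewrite LE ler_pdivlMr //; apply: le_trans ey; rewrite expr2; lra.
have lnL : ln L = y - ln y by rewrite LE ln_div ?posrE ?expR_gt0 // expRK.
have lny0 : 0 <= ln y by exact: ln_ge0.
have lny : ln y <= eta * y by exact: ln_le_linear.
have e0 := expR_gt0 y.
split; split.
- by rewrite -ltr_ln ?posrE // ln1.
- by rewrite lty; have := expR_ge1Dx y; move: Ay; lra.
- by apply: le_trans Ly2; lra.
- by apply: le_trans Ly2; lra.
- rewrite lty LE mulrC ler_wpM2r ?(ltW e0) //.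
  by rewrite -[leRHS]invrK lef_pV2 ?posrE ?invr_gt0.
- rewrite lnL LE lty -mulrA mulrC ler_wpM2l ?(ltW e0) //.
  by rewrite mulrC ler_pdivlMr // mulrBl mul1r; lra.
- rewrite lnL LE lty -[leRHS]mulr1 -mulrA ler_wpM2l ?(ltW e0) //.
  by rewrite mulrC ler_pdivrMr // mul1r; lra.
Unshelve. all: by end_near.
Qed.

(** * Smallness of the two main error probabilities *)

(** The base b of the Chernoff bound satisfies ln b <= k0 - alpha ln L, as N and p are at least
    constant multiples of L. Hence ln (t b^p) is at most ln t - (1 + alpha delta) L ln L + O(L),
    which is below -(alpha delta / 2) ln t for large t. *)
Lemma late_term_small {R : realType} (alpha delta c eta : R) :
  1 < alpha -> 0 < delta -> 0 < c -> 0 < eta ->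
  \forall t \near +oo, let L := ln t / ln (ln t) in
  forall p N : nat, (alpha^-1 + delta) * L <= p%:R -> delta * L / 2 <= N%:R ->
  (Num.truncn t).+1%:R * (expR 1 * (c * (N%:R `^ (1 - alpha) / (alpha - 1))) / p%:R) ^+ p <= eta.
Proof.
move=> a1 d0 c0 eta0; have a0 : 0 < alpha by exact: lt_trans a1.
have am0 : 0 < alpha - 1 by rewrite subr_gt0.
(* [k0] collects the constants in the bound on ln b, and [k1] times L bounds their contribution to
   the exponent. *)
pose k0 := 1 + ln (c / (alpha - 1)) + (1 - alpha) * ln (delta / 2) + ln alpha.
pose k1 := (alpha^-1 + delta) * `|k0|.
have ia0 : 0 < alpha^-1 by rewrite invr_gt0.
have k10 : 0 <= k1 by rewrite mulr_ge0 // addr_ge0 // ltW.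
have ad0 : 0 < alpha * delta by rewrite mulr_gt0.
(* Tolerance for both L / ln t and the relative error in L ln L ~ ln t: the errors together use up
   half of the gain alpha delta. *)
pose h := alpha * delta / (2 * (k1 + 1 + alpha * delta)).
have kd0 : 0 < k1 + 1 + alpha * delta by rewrite addr_gt0 // ltr_wpDl.
have h0 : 0 < h by rewrite divr_gt0 // mulr_gt0.
have hE : h * (k1 + 1 + alpha * delta) = alpha * delta / 2.
  by rewrite /h; field; rewrite gt_eqF.
near=> t.
have [[t1 Alt L1] [AL Llt lowLL upLL]] : let L := ln t / ln (ln t) in
    [/\ 1 < t, Num.max (expR `|k0|) (4 / (alpha * delta * eta)) <= ln t & 1 <= L] /\
    [/\ Num.max (expR `|k0|) (4 / (alpha * delta * eta)) <= L, L <= h * ln t,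
       (1 - h) * ln t <= L * ln L & L * ln L <= ln t].
  by near: t; exact: loglog_asymptotics.
set L := ln t / ln (ln t) in L1 AL Llt lowLL upLL *; clearbody L => p N pL NL.
have L0 : 0 < L by exact: lt_le_trans L1.
have t0 : 0 < t by exact: lt_trans t1.
have p0 : 0 < p%:R :> R by apply: lt_le_trans pL; rewrite mulr_gt0 // addr_gt0.
have dL0 : 0 < delta * L / 2 by rewrite divr_gt0 // mulr_gt0.
have N0 : 0 < N%:R :> R by exact: lt_le_trans NL.
set b := expR 1 * _ / _.
have cb0 : 0 < c / (alpha - 1) by rewrite divr_gt0.
have bE : b = expR (1 + ln (c / (alpha - 1)) + (1 - alpha) * ln N%:R - ln p%:R).
  rewrite !expRD expRN (lnK (_ : p%:R \is Num.pos)) ?posrE // (lnK (_ : c / _ \is Num.pos)) ?posrE //.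
  rewrite /b /powR gt_eqF //; ring.
have lnNL : ln (delta / 2) + ln L <= ln N%:R.
  rewrite -lnM ?posrE ?divr_gt0 // ler_ln ?posrE ?mulr_gt0 ?divr_gt0 //.
  by apply: le_trans NL; rewrite mulrAC.
have lnpL : ln L - ln alpha <= ln p%:R.
  rewrite -ln_div ?posrE // ler_ln ?posrE ?divr_gt0 //; apply: le_trans pL.
  by rewrite mulrC ler_wpM2r ?(ltW L0) // lerDl ltW.
have lnL : `|k0| <= ln L.
  rewrite -ler_expR lnK ?posrE //; apply: le_trans AL.
  by rewrite le_max lexx.
have lnb : ln b <= k0 - alpha * ln L.
  rewrite bE expRK /k0.
  have : (alpha - 1) * (ln (delta / 2) + ln L) <= (alpha - 1) * ln N%:R.
    by rewrite ler_wpM2l // ltW.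
  by move: lnpL; lra.
(* This sign allows p to be replaced by its lower bound in the exponent. *)
have k0L : k0 - alpha * ln L <= 0.
  have := ler_norm k0; have : 0 <= (alpha - 1) * ln L.
    by rewrite mulr_ge0 ?(ltW am0) // (le_trans _ lnL).
  by move: lnL; lra.
have bp : b ^+ p <= expR ((alpha^-1 + delta) * L * (k0 - alpha * ln L)).
  rewrite bE -expRM_natl ler_expR -[X in _ * X](expRK) -bE.
  apply: (@le_trans _ _ (p%:R * (k0 - alpha * ln L))).
    by rewrite ler_wpM2l // ltW.
  by rewrite ler_wnM2r.
have tp : (Num.truncn t).+1%:R <= 2 * expR (ln t).
  rewrite lnK ?posrE // -natr1.
  by have /andP[tt _] := truncn_itv (ltW t0); move: tt t1; lra.
have lt0 : 0 < ln t by rewrite ln_gt0.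
have expo : ln t + (alpha^-1 + delta) * L * (k0 - alpha * ln L) <= - (alpha * delta / 2) * ln t.
  have kL : (alpha^-1 + delta) * L * k0 <= k1 * (h * ln t).
    apply: (@le_trans _ _ (k1 * L)); last by rewrite ler_wpM2l.
    rewrite /k1 mulrAC ler_wpM2r ?(ltW L0) // ler_wpM2l ?ler_norm //.
    by rewrite addr_ge0 // ltW.
  have aE : (alpha^-1 + delta) * alpha = 1 + alpha * delta.
    by rewrite mulrDl mulVf ?gt_eqF // (mulrC delta).
  have LL : (1 + alpha * delta) * ((1 - h) * ln t) <= (1 + alpha * delta) * (L * ln L).
    by rewrite ler_wpM2l // addr_ge0 // ltW.
  have E1 : (alpha^-1 + delta) * L * (k0 - alpha * ln L) =
      (alpha^-1 + delta) * L * k0 - ((alpha^-1 + delta) * alpha) * (L * ln L) by ring.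
  rewrite E1 aE.
  have E2 : h * (k1 + 1 + alpha * delta) * ln t = alpha * delta / 2 * ln t by rewrite hE.
  by move: E2 kL LL; lra.
apply: (@le_trans _ _ (2 * expR (ln t) * expR ((alpha^-1 + delta) * L * (k0 - alpha * ln L)))).
  by apply: ler_pM => //; rewrite bE -expRM_natl expR_ge0.
rewrite -mulrA -expRD.
apply: (@le_trans _ _ (2 * expR (- (alpha * delta / 2) * ln t))).
  by rewrite ler_wpM2l // ler_expR.
rewrite mulNr expRN ler_pdivrMr ?expR_gt0 //.
have tA : 4 / (alpha * delta * eta) <= ln t.
  by apply: le_trans Alt; rewrite le_max lexx orbT.
have : 2 <= eta * (alpha * delta / 2 * ln t).
  move: tA; rewrite ler_pdivrMr ?mulr_gt0 // => tA.
  by move: tA; lra.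
move=> /le_trans; apply; rewrite ler_wpM2l ?(ltW eta0) //.
by have := expR_ge1Dx (alpha * delta / 2 * ln t); lra.
Unshelve. all: by end_near.
Qed.

(** Since (1 - q^n)^N <= exp(-N q^n), it is enough that N q^n >= 1 / eta. Here ln N is at least ln t
    - O(L), and -n ln q is at most alpha n ln n + O(L), hence at most (1 - alpha delta) ln t + O(L);
    this leaves alpha delta ln t - O(L). *)
Lemma block_term_small {R : realType} (alpha delta c eta : R) :
  1 < alpha -> 0 < delta -> delta < alpha^-1 -> 0 < c -> 0 < eta ->
  \forall t \near +oo, let L := ln t / ln (ln t) in
  forall (n N : nat) (q : R), (0 < n)%N -> n%:R <= (alpha^-1 - delta) * L ->
  c * n%:R `^ (- alpha) <= q -> q <= 1 -> t / n%:R - 1 <= N%:R ->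
  (1 - q ^+ n) ^+ N <= eta.
Proof.
move=> a1 d0 da c0 eta0; have a0 : 0 < alpha by exact: lt_trans a1.
have ia0 : 0 < alpha^-1 by rewrite invr_gt0.
have ia1 : alpha^-1 < 1 by rewrite invf_lt1.
have ad0 : 0 < alpha * delta by rewrite mulr_gt0.
have ad1 : alpha * delta < 1 by rewrite mulrC -ltr_pdivlMr // div1r.
pose k1 : R := `|ln c|.
have k10 : 0 <= k1 by exact: normr_ge0.
(* Keeps the errors n ln c and ln L within half of alpha delta ln t. *)
pose h := alpha * delta / (2 * (k1 + 1)).
have kd0 : 0 < k1 + 1 by rewrite ltr_wpDl.
have h0 : 0 < h by rewrite divr_gt0 // mulr_gt0.
have hE : h * (k1 + 1) = alpha * delta / 2 by rewrite /h; field; rewrite gt_eqF.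
near=> t.
pose A := 2 * (1 + eta^-1) / (alpha * delta).
have [[t1 Alt L1] [_ Llt lowLL upLL]] : let L := ln t / ln (ln t) in
    [/\ 1 < t, Num.max A 4 <= ln t & 1 <= L] /\
    [/\ Num.max A 4 <= L, L <= (Num.min h 4^-1) * ln t,
       (1 - Num.min h 4^-1) * ln t <= L * ln L & L * ln L <= ln t].
  near: t; apply: loglog_asymptotics; rewrite lt_min h0 /= invr_gt0 //.
set L := ln t / ln (ln t) in L1 Llt lowLL upLL *; clearbody L => n N q n0 nL cq q1 tN.
have L0 : 0 < L by exact: lt_le_trans L1.
have t0 : 0 < t by exact: lt_trans t1.
have lt0 : 0 < ln t by rewrite ln_gt0.
have nR : 0 < n%:R :> R by rewrite ltr0n.
have n1 : 1 <= n%:R :> R by rewrite ler1n.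
have nL1 : n%:R <= L.
  by apply: le_trans nL _; rewrite ler_piMl ?(ltW L0) //; move: ia1 d0; lra.
have Lh : L <= h * ln t.
  by apply: le_trans Llt _; rewrite ler_wpM2r ?(ltW lt0) // ge_min lexx.
have L4 : L <= 4^-1 * ln t.
  by apply: le_trans Llt _; rewrite ler_wpM2r ?(ltW lt0) // ge_min lexx orbT.
have lnL : ln L <= L by apply/ltW/ln_sublinear.
have lnt : ln t <= t by apply/ltW/ln_sublinear.
(* From n <= L <= ln t / 4 follows t / (2 n) >= 1, so the rounding loss 1 is at most half of t /
   n. *)
have t2n : t / (2 * n%:R) <= N%:R.
  apply: le_trans tN; rewrite lerBrDr -lerBrDl.
  have -> : t / n%:R - t / (2 * n%:R) = t / (2 * n%:R) by field; rewrite gt_eqF.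
  rewrite ler_pdivlMr ?mulr_gt0 //.
  by move: nL1 L4 lnt; lra.
have N0 : 0 < N%:R :> R by apply: lt_le_trans t2n; rewrite divr_gt0 // mulr_gt0.
have lnN : ln t - 1 - ln L <= ln N%:R.
  apply: (@le_trans _ _ (ln (t / (2 * n%:R)))); last first.
    by rewrite ler_ln ?posrE // divr_gt0 // mulr_gt0.
  rewrite ln_div ?posrE ?mulr_gt0 // lnM ?posrE //.
  have : ln n%:R <= ln L by rewrite ler_ln ?posrE.
  have : ln 2 <= 1 :> R by have := @le_ln1Dx R 1 _; rewrite (_ : 1 + 1 = 2) //; apply; lra.
  by lra.
have q0 : 0 < q by apply: lt_le_trans cq; rewrite mulr_gt0 // powR_gt0.
have lnq : ln c - alpha * ln n%:R <= ln q.
  rewrite -[X in _ - X]opprK -mulNr -ln_powR opprK -lnM ?posrE ?powR_gt0 //.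
  by rewrite ler_ln ?posrE // mulr_gt0 // powR_gt0.
have Nq : eta^-1 <= N%:R * q ^+ n.
  have -> : N%:R * q ^+ n = expR (ln N%:R + n%:R * ln q).
    by rewrite expRD expRM_natl !lnK ?posrE.
  apply: (@le_trans _ _ (ln N%:R + n%:R * ln q)); last first.
    by have := expR_ge1Dx (ln N%:R + n%:R * ln q); lra.
  have nq : n%:R * (ln c - alpha * ln n%:R) <= n%:R * ln q by rewrite ler_wpM2l // ltW.
  have nc : - (k1 * L) <= n%:R * ln c.
    rewrite lerNl -mulrN; apply: (@le_trans _ _ (n%:R * k1)).
      by rewrite ler_wpM2l ?(ltW nR) // /k1 -normrN ler_norm.
    by rewrite mulrC ler_wpM2l.
  have nln : n%:R * ln n%:R <= (alpha^-1 - delta) * L * ln L.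
    apply: ler_pM; rewrite ?(ltW nR) ?ln_ge0 //.
    by rewrite ler_ln ?posrE.
  have nln2 : alpha * (n%:R * ln n%:R) <= (1 - alpha * delta) * ln t.
    apply: (@le_trans _ _ (alpha * ((alpha^-1 - delta) * L * ln L))).
      by rewrite ler_wpM2l // ltW.
    have -> : alpha * ((alpha^-1 - delta) * L * ln L) = (1 - alpha * delta) * (L * ln L).
      by field; rewrite gt_eqF.
    rewrite ler_wpM2l //.
    by rewrite subr_ge0 ltW.
  have kL : (k1 + 1) * L <= alpha * delta / 2 * ln t.
    by rewrite -hE [h * _]mulrC -mulrA ler_wpM2l // ltW.
  have At : 1 + eta^-1 <= alpha * delta / 2 * ln t.
    have : A <= ln t by apply: le_trans Alt; rewrite le_max lexx.
    by rewrite /A ler_pdivrMr //; lra.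
  by move: lnN nq nc nln2 kL At lnL; lra.
have qn1 : q ^+ n <= 1 by rewrite exprn_ile1 // ltW.
apply: (@le_trans _ _ (expR (- (N%:R * q ^+ n)))).
  rewrite -mulrN expRM_natl; apply: lerXn2r; rewrite ?nnegrE ?subr_ge0 ?expR_ge0 //.
  exact: expR_ge1Dx.
rewrite expRN -[leRHS]invrK lef_pV2 ?posrE ?invr_gt0 ?expR_gt0 //.
by apply: le_trans Nq _; have := expR_ge1Dx (N%:R * q ^+ n); lra.
Unshelve. all: by end_near.
Qed.

(** * Choice of the parameters and convergence in probability of the rescaled workload *)

Theorem theorem5 (R : realType) (d : measure_display) (T : measurableType d)
    (P : probability T R) (xi : int -> {RV P >-> R}) (U : {RV P >-> R})
    (xi_iid : iid xi) (U_unif : uniform01 U)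
    (U_indep : independent_of_family U xi)
    (xi_neg : ('E_P[(fun w => Num.max (- xi 0 w) 0)%R] < +oo)%E)
    (c alpha : R) (c_gt0 : 0 < c) (alpha_gt1 : 1 < alpha)
    (xi_tail : fine (ccdf (xi 0) x) / (c * x `^ (- alpha)) @[x --> +oo] --> (1 : R)) :
  cvg_in_distribution P
    (fun (t : R) (w : T) => workload (fun j => xi j) U t w / (ln t / ln (ln t)))
    (\d_(alpha^-1)).
Proof.
have [S S0 eS] := early_sum P xi xi_iid.2 xi_neg.
have [x0 x00 tail] := tail_bounds c alpha _ c_gt0 xi_tail.
have a0 : 0 < alpha by exact: lt_trans alpha_gt1.
have ia0 : 0 < alpha^-1 by rewrite invr_gt0.
have am0 : 0 < alpha - 1 by rewrite subr_gt0.
apply: cvg_in_distribution_dirac.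
  near=> t; have t0 : 0 <= t by near: t; exact: nbhs_pinfty_ge.
  apply: measurable_funM; last exact: measurable_cst.
  by apply: measurable_workload => // j; exact: measurable_funP.
move=> eps eta eps0 eta0.
(* The lower bound on W(t) loses delta L once through n, twice through e = delta L, once through the
   customers left out, and once through rounding: five times in all. The second bound keeps 1 /
   alpha - delta positive. *)
pose delta : R := Num.min (eps / 5) (alpha^-1 / 2).
have d0 : 0 < delta by rewrite lt_min !divr_gt0.
have deps : 5 * delta <= eps.
  by rewrite mulrC -ler_pdivlMr // /delta ge_min lexx.
have da : delta < alpha^-1.
  by apply: (@le_lt_trans _ _ (alpha^-1 / 2)); [rewrite /delta ge_min lexx orbT|lra].
have ad0 : 0 < alpha^-1 - delta by rewrite subr_gt0.
pose M : R := 2 * c / (alpha - 1).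
have M0 : 0 < M by rewrite divr_gt0 // mulr_gt0.
(* Five terms bound the bad event, S / e occurring twice. *)
have eta50 : 0 < eta / 5 by rewrite divr_gt0.
near=> t.
set L := ln t / ln (ln t).
(* The entries serve, in turn: N0 >= x0 and rounding errors below delta L; n >= x0; S / (delta L) <=
   eta / 5; mu / (delta L) <= eta / 5. *)
pose A : R := Num.max ((x0 + 4) / delta) (Num.max ((x0 + 2) / (alpha^-1 - delta))
  (Num.max (S / (delta * (eta / 5))) (M / (delta * (eta / 5))))).
have [[t1 _ L1] [AL _ _ _]] : let L := ln t / ln (ln t) in
    [/\ 1 < t, A <= ln t & 1 <= L] /\
    [/\ A <= L, L <= 1 * ln t, (1 - 1) * ln t <= L * ln L & L * ln L <= ln t].
  by near: t; apply: loglog_asymptotics.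
have late_small : let L := ln t / ln (ln t) in
    forall p N : nat, (alpha^-1 + delta) * L <= p%:R -> delta * L / 2 <= N%:R ->
    (Num.truncn t).+1%:R * (expR 1 * (2 * c * (N%:R `^ (1 - alpha) / (alpha - 1))) / p%:R) ^+ p <= eta / 5.
  by near: t; apply: late_term_small => //; rewrite mulr_gt0.
have block_small : let L := ln t / ln (ln t) in
    forall (n N : nat) (q : R), (0 < n)%N -> n%:R <= (alpha^-1 - delta) * L ->
    c / 2 * n%:R `^ (- alpha) <= q -> q <= 1 -> t / n%:R - 1 <= N%:R ->
    (1 - q ^+ n) ^+ N <= eta / 5.
  by near: t; apply: block_term_small => //; rewrite divr_gt0.
move: late_small block_small; rewrite /= -/L -/L => late_small block_small.
rewrite -/L in L1 AL.
have L0 : 0 < L by exact: lt_le_trans L1.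
have t0 : 0 < t by exact: lt_trans t1.
have [AL1 AL2 AL3 AL4] : [/\ x0 + 4 <= delta * L, x0 + 2 <= (alpha^-1 - delta) * L,
    S <= delta * L * (eta / 5) & M <= delta * L * (eta / 5)].
  move: AL; rewrite /A !ge_max => /andP[+ /andP[+ /andP[+ +]]].
  rewrite ler_pdivrMr // (mulrC L) => ->; rewrite ler_pdivrMr // (mulrC L) => ->.
  by rewrite !ler_pdivrMr ?mulr_gt0 // => ? ?; split=> //; rewrite -mulrA mulrCA.
clearbody L.
have dL0 : 0 < delta * L by rewrite mulr_gt0.
(* The last [N0.+1] customers are left out, [p] is the threshold for late ones, [n] the block length
   and [N] the number of blocks fitting before t. *)
pose N0 := Num.truncn (delta * L).
pose p := (Num.truncn ((alpha^-1 + delta) * L)).+1.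
pose n := Num.truncn ((alpha^-1 - delta) * L).
pose N := Num.truncn (t / n%:R).
have trunc_bounds (x : R) : 0 <= x -> (Num.truncn x)%:R <= x /\ x < (Num.truncn x)%:R + 1.
  by move=> /truncn_itv /andP[? ?]; split => //; rewrite natr1.
have [N01 N02] := trunc_bounds _ (ltW dL0); rewrite -/N0 in N01 N02.
have [p1 p2] : (Num.truncn ((alpha^-1 + delta) * L))%:R <= (alpha^-1 + delta) * L /\
    (alpha^-1 + delta) * L < p%:R.
  have [] := trunc_bounds ((alpha^-1 + delta) * L); last by rewrite natr1.
  by rewrite mulr_ge0 ?(ltW L0) // addr_ge0 // ltW.
have pE : p%:R = (Num.truncn ((alpha^-1 + delta) * L))%:R + 1 :> R by rewrite natr1.
have [n1 n2] := trunc_bounds _ (mulr_ge0 (ltW ad0) (ltW L0)); rewrite -/n in n1 n2.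
have nx0 : x0 <= n%:R by move: n2 AL2; lra.
have n0 : (0 < n)%N by rewrite -(ltr_nat R); exact: lt_le_trans nx0.
have nR : 0 < n%:R :> R by rewrite ltr0n.
have [Nt1 Nt2] := trunc_bounds _ (divr_ge0 (ltW t0) (ltW nR)); rewrite -/N in Nt1 Nt2.
have N0x0 : x0 <= N0%:R by move: N02 AL1; lra.
have N00 : (0 < N0)%N by rewrite -(ltr_nat R); exact: lt_le_trans N0x0.
pose mu : R := 2 * c * (N0%:R `^ (1 - alpha) / (alpha - 1)).
have mu0 : 0 < mu by apply: mulr_gt0; [rewrite mulr_gt0|rewrite divr_gt0 // powR_gt0 // ltr0n].
(* A bound free of t suffices for the Markov term, where mu is divided by delta L. *)
have muM : mu <= M.
  rewrite /mu /M mulrA ler_pM2r ?invr_gt0 // ler_piMr ?mulr_ge0 ?(ltW c_gt0) //.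
  rewrite -[leRHS](powRr0 N0%:R) ler_powR ?ler1n //.
  by rewrite subr_le0 ltW.
pose q := fine (ccdf (xi 0) n%:R).
have qE : ccdf (xi 0) n%:R = q%:E by rewrite fineK // fin_num_measure.
have q1 : q <= 1 by rewrite -lee_fin -qE probability_le1.
have [||B [mB PB HB]] := workload_concentration P xi U t (delta * L) mu S q N0.+1 p n N
    xi_iid U_unif (ltW t0) dL0 mu0 S0 isT _ eS qE.
- move=> m; apply: (late_sum P xi (2 * c) alpha x0 m N0 xi_iid.2) => //.
    by rewrite mulr_ge0 // ltW.
  by move=> x /tail /andP[].
- by rewrite natrM -ler_pdivlMr.
exists B; split=> //.
  apply: le_trans PB _; rewrite lee_fin.
  have T1 : (Num.truncn t).+1%:R * (expR 1 * mu / p%:R) ^+ p <= eta / 5.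
    by apply: late_small; [exact: ltW|move: N02 AL1; lra].
  have T2 : S / (delta * L) <= eta / 5 by rewrite ler_pdivrMr // mulrC.
  have T3 : mu / (delta * L) <= eta / 5 by rewrite ler_pdivrMr // mulrC (le_trans muM).
  have T4 : (1 - q ^+ n) ^+ N <= eta / 5.
    apply: block_small => //; first by have /andP[] := tail _ nx0.
    by move: Nt2; lra.
  by move: T1 T2 T3 T4; lra.
move=> w /HB; set W := workload _ _ _ _ => /andP[W1 W2].
have N01E : N0.+1%:R = N0%:R + 1 :> R by rewrite natr1.
have dLe : 5 * (delta * L) <= eps * L by rewrite mulrA ler_wpM2r // ltW.
rewrite ler_distl; apply/andP; split.
  by rewrite ler_pdivlMr //; move: W1 N01E N01 n2 AL1 x00 dLe; lra.
by rewrite ler_pdivrMr //; move: W2 N01E N01 p1 pE AL1 x00 dLe; lra.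
Unshelve. all: by end_near.
Qed.
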